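(* Let $n \ge 3$ be an integer. There exist constants $c_1(n) > 0$ and $Q_0(n) > 0$, depending only on $n$, such that for every real $Q > Q_0(n)$ and every real $v$ with $1.4 \le v \le \frac{7}{16}(n+1)$ we have \[ \# \mathcal{P}_n(Q,v,I_0) \le c_1(n)\, Q^{\,n+1-\frac{v}{7}} . \]
   Context: For a polynomial $P(x) = a_n x^n + \dots + a_1 x + a_0 \in \mathbb{C}[x]$ its height is $H(P) = \max_{0 \le i \le n} |a_i|$. Let $I_0 = \left(-\tfrac12, \tfrac12\right)$. For an integer $n \ge 1$, reals $Q \ge 1$, $v \ge 0$ and a set $D \subseteq \mathbb{C}$, let $\mathcal{P}_n(Q,v,D)$ denote the set of primitive irreducible polynomials $P \in \mathbb{Z}[x]$ with $\deg P = n$ exactly, $H(P) \le Q$, positive leading coefficient, and having a root $\alpha \in D$ such that $|P'(\alpha)| < Q^{1-v}$. (Equivalently, this counts algebraic numbers $\alpha$ of degree $n$ and height at most $Q$ in $D$ whose minimal polynomial has small derivative at $\alpha$.) *)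

(* Defs.v *)
From HB Require Import structures.
From Stdlib Require Import Reals ZArith.
From mathcomp Require Import all_boot all_order all_algebra.
Set Implicit Arguments. Unset Strict Implicit. Unset Printing Implicit Defensive.
Import Order.TTheory GRing.Theory Num.Theory.
Local Open Scope R_scope.

Definition int_to_Z (z : int) : Z :=
  match z with
  | Posz k => Z.of_nat k
  | Negz k => Z.opp (Z.of_nat k.+1)
  end.
Definition int_to_R (z : int) : R := IZR (int_to_Z z).

Definition evalR (p : {poly int}) (x : R) : R :=
  foldr (fun c acc => (int_to_R c + x * acc)) 0 (polyseq p).

Definition height_le (p : {poly int}) (Q : R) : Prop :=
  forall i : nat, Rabs (int_to_R (p`_i)%R) <= Q.

Definition primitive (p : {poly int}) : Prop :=
  forall d : int, (forall i : nat, (p`_i)%R \in dvdz d) -> d = 1%R \/ d = (-1)%R.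

Definition irreducibleZ (p : {poly int}) : Prop :=
  p != 0%R /\ ~~ (p \is a GRing.unit) /\
  forall a b : {poly int}, p = (a * b)%R ->
    (a \is a GRing.unit) \/ (b \is a GRing.unit).

Definition I0 (x : R) : Prop := - / 2 < x < / 2.

Definition inPn (n : nat) (Q v : R) (D : R -> Prop) (p : {poly int}) : Prop :=
  primitive p /\ irreducibleZ p /\
  (size p = n.+1)%N /\
  height_le p Q /\
  (0 < lead_coef p)%R /\
  exists alpha : R, D alpha /\ evalR p alpha = 0 /\
    Rabs (evalR (p^`()) alpha) < Rpower Q (1 - v).

(* Main.v *)
Require Import Defs.
From HB Require Import structures.
From Stdlib Require Import Reals ZArith Lra.
From mathcomp Require Import all_boot all_order all_algebra.
Set Implicit Arguments. Unset Strict Implicit. Unset Printing Implicit Defensive.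

(** Put s = v/7. A grid of about Q^(2s) points x of [-1/2, 1/2] is such that every
   polynomial counted satisfies |P(x)| << Q^(1-4s) at one of them, so it suffices to
   find at most O(Q^(n+1-3s)) polynomials at each x.

   Fix x and suppose there are more. By pigeonhole on the leading coefficients, for
   every r <= n there are many integer polynomials of degree <= r and height << Q
   that are << Q^(1-4s) at x. They span a space W_r of dimension d_r, and their
   number forces the codimension r+1-d_r to be < 3s. Since x W_r is contained in
   W_(r+1), d_r grows by at least one at each step, and for some r between n-3s-1
   and n-1 by exactly one. Then the degrees occurring in W_r form an interval and
   W_r consists of the multiples, of degree <= r, of one polynomial G. Let d = d_r
   and c = r+1-d, so that deg G <= c. The quotients by G form a set of integer
   points spanning a space of dimension d, so their number is bounded by a maximal
   determinant; this bounds the height of G by Q^((3s-c)/d) and makes |G(x)| small.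
   But the irreducible polynomials P of degree n are coprime to G, and both are
   small at x, so their resultant is less than 1 in absolute value. *)

(** * The exponents *)

Ltac rlra := lra.
Ltac rnra := nra.
Ltac rring := ring.
Ltac rfield := field.

Local Open Scope R_scope.

Lemma INR_subn m n : (n <= m)%N -> INR (m - n)%N = INR m - INR n.
Proof. by move=> /ssrnat.leP; apply: minus_INR. Qed.

(** Since [c <= 4 * s], the left side does not increase with [d], so [d] may be replaced by its
    lower bound [n - 3 * s - c]. This leaves [- n * s + 12 * s ^ 2 + s * c - c ^ 2]. Inserting
    [n >= 16 * s - 1] and [s <= s * c] bounds it by [- (3 * s ^ 2) - (s - c) ^ 2]. The upper bound
    on v enters here. *)
Lemma exponent_leq (n c d k s : R) :
    / 5 <= s -> 16 * s <= n + 1 -> k <= 3 * s + 1 -> n + 1 <= c + d + k -> 1 <= c ->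
    c <= 3 * s ->
  n * (3 * s - c) - d * (4 * s - c) <= - (3 * s ^ 2).
Proof.
move=> s5 sn ks ncdk c1 cs.
have hd : n - 3 * s - c <= d by lra.
have : (n - 3 * s - c) * (4 * s - c) <= d * (4 * s - c) by apply: Rmult_le_compat_r; lra.
have : 0 <= s * (n + 1 - 16 * s) by apply: Rmult_le_pos; lra.
have : 0 <= s * (c - 1) by apply: Rmult_le_pos; lra.
have := pow2_ge_0 (s - c).
nra.
Qed.

Lemma exp_monotone x y : x <= y -> exp x <= exp y.
Proof. by case=> [/exp_increasing|->]; [left | right]. Qed.

(* With [H = Q^eta], [a] and [b] bound [eta] and [Y], and both terms of [r] become
   at most [Q] to the power [(n(3s-c) - d(4s-c))/d]. *)
Lemma exponents_contradiction (n c d g k : nat) (Q s N H Y C C1 : R) :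
    1 < Q -> / 5 <= s -> 16 * s <= INR n + 1 -> INR k <= 3 * s + 1 ->
    (c + d <= n)%N -> (n < c + d + k)%N -> (0 < d)%N -> (g <= c)%N ->
    1 <= H -> 0 <= Y -> (g = 0%N -> H = 1 /\ Y = 1) -> 1 <= C -> 0 < C1 ->
    C * (1 + C1) * Rpower Q (INR n + 1 - 3 * s) < N ->
    N * H ^ d <= C * Q ^ (n.+1 - c) ->
    N * H ^ d.-1 * Y <= C * Q ^ (n - c) * (C1 * Rpower Q (1 - 4 * s)) ->
    ((0 < g)%N -> 1 <= C * (C1 * Rpower Q (1 - 4 * s) * Q ^ g.-1 * H ^ n +
                           Y * Q ^ g * H ^ n.-1)) ->
    C * (1 + C1) < Rpower Q (3 / (25 * INR n)) ->
  False.
Proof.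
move=> Q1 s5 sn ks cdn ncdk d_gt0 gc H1 Y0 g0 C_ge1 C1_gt0 bigN a b r hQ.
have L_gt0 : 0 < ln Q by rewrite -ln_1; apply: ln_increasing; lra.
have lh_ge0 : 0 <= ln H.
  by case: H1 => [H1|<-]; [left; rewrite -ln_1; apply: ln_increasing; lra | rewrite ln_1; lra].
set L := ln Q in L_gt0 *; set lh := ln H in lh_ge0 *.
have powQ m : Q ^ m = exp (INR m * L) by rewrite -Rpower_pow //; lra.
have powH m : H ^ m = exp (INR m * lh) by rewrite -Rpower_pow //; lra.
have rpQ y : Rpower Q y = exp (y * L) by [].
have cn : (c <= n)%N by apply: leq_trans (leq_addr _ _) cdn.
have dn : (d <= n)%N by apply: leq_trans (leq_addl _ _) cdn.
have d_ge1 : 1 <= INR d by rewrite -[1]/(INR 1); apply/le_INR/ssrnat.leP.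
have dnR : INR d <= INR n by apply/le_INR/ssrnat.leP.
have c_ge0 : 0 <= INR c by apply: pos_INR.
have dE : INR d.-1 = INR d - 1 by rewrite -subn1 INR_subn.
have N_gt0 : 0 < N.
  by apply: Rlt_trans bigN; apply: Rmult_lt_0_compat; [nra | apply: exp_pos].
set E0 := exp ((INR n + 1 - 3 * s) * L).
have E0_gt0 : 0 < E0 by apply: exp_pos.
have bigN' : C * (1 + C1) * E0 < N by rewrite /E0 -rpQ.
have C_gt0 : 0 < C by lra.
have CE : 0 < C * E0 by apply: Rmult_lt_0_compat.
have CCE : 0 < C * C1 * E0 by do !apply: Rmult_lt_0_compat.
have CEN : C * E0 + C * C1 * E0 < N by move: bigN'; rewrite Rmult_plus_distr_l; lra.
(* Dividing [a] by the lower bound [bigN] cancels the constant: [H ^ d] is below [Q] to the power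
   [3 * s - c]. As [H >= 1], this also forces [c < 3 * s]. *)
have a' : INR d * lh < (3 * s - INR c) * L.
  apply: exp_lt_inv; rewrite -powH.
  apply: (Rmult_lt_reg_l (C * E0)) => //.
  have -> : C * E0 * exp ((3 * s - INR c) * L) = C * Q ^ (n.+1 - c).
    rewrite powQ INR_subn; last exact: leqW.
    by rewrite /E0 Rmult_assoc -exp_plus S_INR; do 2 f_equal; ring.
  apply: Rlt_le_trans a; apply: Rmult_lt_compat_r; first by rewrite powH; apply: exp_pos.
  lra.
have c_lt : INR c < 3 * s by nra.
have b' : H ^ d.-1 * Y <= exp ((- INR c - s) * L).
  apply: (Rmult_le_reg_l (C * C1 * E0)) => //.
  have -> : C * C1 * E0 * exp ((- INR c - s) * L) =
      C * Q ^ (n - c) * (C1 * Rpower Q (1 - 4 * s)).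
    rewrite powQ rpQ INR_subn // /E0.
    transitivity (C * C1 * exp ((INR n + 1 - 4 * s - INR c) * L)).
      by rewrite Rmult_assoc -exp_plus; do 2 f_equal; ring.
    rewrite (_ : forall t u : R, C * t * (C1 * u) = C * C1 * (t * u)); last by move=> *; ring.
    by rewrite -exp_plus; do 2 f_equal; ring.
  apply: Rle_trans b; rewrite [N * _ * _]Rmult_assoc; apply: Rmult_le_compat_r; last lra.
  by apply: Rmult_le_pos => //; rewrite powH; left; apply: exp_pos.
(* If [g = 0] then [H = Y = 1], and [b'] would bound [1] by a negative power of [Q]. *)
have [g_0|g_gt0] := posnP g.
  have [H_1 Y_1] := g0 g_0; move: b'; rewrite H_1 Y_1 pow1 Rmult_1_l.
  by have := exp_increasing ((- INR c - s) * L) 0; rewrite exp_0; nra.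
have c_ge1 : 1 <= INR c.
  by rewrite -[1]/(INR 1); apply/le_INR/ssrnat.leP; apply: leq_trans gc.
have gcR : INR g <= INR c by apply/le_INR/ssrnat.leP.
have ncdkR : INR n + 1 <= INR c + INR d + INR k.
  by rewrite -S_INR -!plus_INR; apply/le_INR/ssrnat.leP.
have E := exponent_leq s5 sn ks ncdkR c_ge1 (Rlt_le _ _ c_lt).
have n_gt0 : 0 < INR n by lra.
have nE : INR n.-1 = INR n - 1 by rewrite -subn1 INR_subn //; apply: leq_trans dn.
have gE : INR g.-1 = INR g - 1 by rewrite -subn1 INR_subn.
(* As [s >= / 5], the saving [3 * s ^ 2] is at least [3 / 25]. Divided by [d <= n], it is still at
   least [kap], and [hQ] says that this power of [Q] beats the constants. *)
set kap := 3 / (25 * INR n).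
have kap_n : kap * INR n = 3 / 25 by rewrite /kap; field; lra.
have kap_gt0 : 0 < kap by apply: Rdiv_lt_0_compat; lra.
have s2 : / 25 <= s ^ 2 by nra.
have kd : kap * INR d <= 3 / 25 by rewrite -kap_n; apply: Rmult_le_compat_l; lra.
have EL : (INR n * (3 * s - INR c) - INR d * (4 * s - INR c)) * L <= - (kap * INR d) * L.
  by apply: Rmult_le_compat_r; lra.
have e1 : INR n * lh + (INR c - 4 * s) * L <= - kap * L.
  apply: (Rmult_le_reg_r (INR d)); first lra.
  have : INR n * (INR d * lh) <= INR n * ((3 * s - INR c) * L).
    by apply: Rmult_le_compat_l; lra.
  by lra.
have e2 : (INR n - INR d) * lh - s * L <= - kap * L.
  apply: (Rmult_le_reg_r (INR d)); first lra.
  have : (INR n - INR d) * (INR d * lh) <= (INR n - INR d) * ((3 * s - INR c) * L).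
    by apply: Rmult_le_compat_l; lra.
  by lra.
have gL : INR g * L <= INR c * L by apply: Rmult_le_compat_r; lra.
have t1 : Rpower Q (1 - 4 * s) * Q ^ g.-1 * H ^ n <= exp (- kap * L).
  rewrite rpQ powQ powH gE -!exp_plus; apply: exp_monotone; lra.
(* [H ^ n.-1] is split into [H ^ (n - d)] and [H ^ d.-1], so that [b'] bounds [Y] together with the
   second factor. *)
have t2 : Y * Q ^ g * H ^ n.-1 <= exp (- kap * L).
  apply: (@Rle_trans _ (exp ((INR n - INR d) * lh + INR g * L) * (H ^ d.-1 * Y))).
    right; rewrite !powH powQ nE dE.
    rewrite (_ : exp _ * (exp _ * Y) = Y * (exp ((INR n - INR d) * lh + INR g * L) * exp ((INR d - 1) * lh))); last by ring.
    by rewrite Rmult_assoc -!exp_plus; do 2 f_equal; ring.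
  apply: (@Rle_trans _ (exp ((INR n - INR d) * lh + INR g * L) * exp ((- INR c - s) * L))).
    by apply: Rmult_le_compat_l => //; left; apply: exp_pos.
  by rewrite -exp_plus; apply: exp_monotone; lra.
have := r g_gt0.
have -> : C * (C1 * Rpower Q (1 - 4 * s) * Q ^ g.-1 * H ^ n + Y * Q ^ g * H ^ n.-1) =
    C * (C1 * (Rpower Q (1 - 4 * s) * Q ^ g.-1 * H ^ n) + Y * Q ^ g * H ^ n.-1) by ring.
set T1 := Rpower _ _ * _ * _ in t1 *; set T2 := Y * _ * _ in t2 *.
have ek : exp (kap * L) * exp (- kap * L) = 1.
  by rewrite -exp_plus (_ : _ + _ = 0) ?exp_0 //; ring.
have ek_gt0 : 0 < exp (- kap * L) by apply: exp_pos.
move: hQ; rewrite rpQ -/kap.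
set ep := exp (kap * L) in ek *; set em := exp (- kap * L) in ek ek_gt0 t1 t2 *.
move=> hQ; have lt1 : C * (1 + C1) * em < 1.
  by rewrite -[X in _ < X]ek; apply: Rmult_lt_compat_r.
have T1em : C1 * T1 <= C1 * em by apply: Rmult_le_compat_l; lra.
have : C * (C1 * T1 + T2) <= C * (C1 * em + em) by apply: Rmult_le_compat_l; lra.
have -> : C * (C1 * em + em) = C * (1 + C1) * em by ring.
lra.
Qed.

Local Close Scope R_scope.

From mathcomp Require Import fingroup perm boolp Rstruct.
From mathcomp Require Import zify ring lra.
Import Order.TTheory GRing.Theory Num.Theory.
Local Open Scope ring_scope.

(** * Heights of integer polynomials *)

Definition hgt (p : {poly int}) : nat := \max_(i < size p) absz (p`_i)%R.

Lemma leq_coef_hgt (p : {poly int}) i : (absz (p`_i)%R <= hgt p)%N.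
Proof.
have [lt_i|le_i] := ltnP i (size p); last by rewrite nth_default.
exact: (@leq_bigmax _ (fun i : 'I_(size p) => absz (p`_i)%R) (Ordinal lt_i)).
Qed.

Lemma hgt_leq (p : {poly int}) B : (forall i, (absz (p`_i)%R <= B)%N) -> (hgt p <= B)%N.
Proof. by move=> pB; apply/bigmax_leqP=> i _; apply: pB. Qed.

Lemma hgt_gt0 (p : {poly int}) : (0 < hgt p)%N = (p != 0).
Proof.
have [->|nz_p] := eqVneq p 0; first by rewrite /hgt size_poly0 big_ord0.
apply: leq_trans (leq_coef_hgt p (size p).-1).
by rewrite absz_gt0 -lead_coefE lead_coef_eq0.
Qed.

Lemma absz_sum_leq (I : Type) (s : seq I) (P : pred I) (F : I -> int) :
  (absz (\sum_(i <- s | P i) F i)%R <= \sum_(i <- s | P i) absz (F i))%N.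
Proof.
elim/big_rec2: _ => [//|i a b _ le_ab].
by apply: leq_trans (leq_add (leqnn _) le_ab); lia.
Qed.

(** Newton interpolation: split off a node [j] by [S = q * ('X - j) + S(j)]. At another node [i],
    [(i - j) * q(i) = S(i) - S(j)] with [|i - j| >= 1], so [q] is at most [2 * B] there and
    induction applies. Multiplying back by ['X - j] with [j <= n] brings the factor to
    [2 * n + 4]. *)
Lemma hgt_interpolation n d (S : {poly int}) (js : seq nat) B :
    (forall j, j \in js -> (j <= n)%N) -> uniq js -> size js = d ->
    (size S <= d)%N -> (forall j, j \in js -> (absz (S.[j%:Z])%R <= B)%N) ->
  (hgt S <= (2 * n + 4) ^ d * B)%N.
Proof.
elim: d S js B => [|d IHd] S js B jsn Ujs size_js sizeS SB.
  move: sizeS; rewrite leqn0 size_poly_eq0 => /eqP->.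
  by rewrite /hgt size_poly0 big_ord0.
case: js => // j js in jsn Ujs size_js SB *.
case/andP: Ujs => js'j Ujs; case: size_js => size_js.
have /factor_theorem[q defS] : root (S - S.[j%:Z]%:P) j%:Z.
  by rewrite rootE !hornerE subrr.
have{defS} defS : S = q * ('X - j%:Z%:P) + S.[j%:Z]%:P by rewrite -defS subrK.
have sizeq : (size q <= d)%N.
  have [->|nz_q] := eqVneq q 0; first by rewrite size_poly0.
  have : (size (S - S.[j%:Z]%:P)%R <= d.+1)%N.
    rewrite (leq_trans (size_polyD _ _)) // geq_max sizeS size_polyN.
    by rewrite (leq_trans (size_polyC_leq1 _)).
  by rewrite {1}defS addrK size_Mmonic ?monicXsubC // size_XsubC addn2.
have qB i : i \in js -> (absz (q.[i%:Z])%R <= 2 * B)%N.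
  move=> js_i; have ne_ij : i != j by apply: contraNneq js'j => <-.
  have := congr1 (horner^~ i%:Z) defS; rewrite !hornerE => eqSi.
  have := SB i; rewrite inE js_i orbT => /(_ isT).
  have := SB j; rewrite inE eqxx => /(_ isT).
  rewrite eqSi => Sj Si; apply: (@leq_trans (absz (q.[i%:Z])%R * absz (i%:Z - j%:Z)%R)%N).
    by rewrite leq_pmulr //; lia.
  by rewrite -abszM; move: Si Sj; set a := (_ * _)%R; set b := S.[_]; clear; lia.
have jsn' i : i \in js -> (i <= n)%N.
  by move=> js_i; apply: jsn; rewrite inE js_i orbT.
have := IHd q js (2 * B)%N jsn' Ujs size_js sizeq qB.
set K := (_ ^ d)%N => hq.
have K_gt0 : (0 < K)%N by rewrite expn_gt0 addnS.
have Sj : (absz (S.[j%:Z])%R <= B)%N by apply: SB; rewrite inE eqxx.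
have jn : (j <= n)%N by apply: jsn; rewrite inE eqxx.
apply: hgt_leq => i; rewrite {1}defS coefD mulrBr coefB coefMX coefMC coefC.
have qi := leq_trans (leq_coef_hgt q i) hq.
have qi1 := leq_trans (leq_coef_hgt q i.-1) hq.
have qij : (absz (q`_i * j%:Z)%R <= K * (2 * B) * n)%N by rewrite abszM leq_mul.
have -> : ((2 * n + 4) ^ d.+1 * B = K * (2 * B) * n + K * (2 * B) + K * B + K * B)%N.
  by rewrite expnS -/K; ring.
have KB : (B <= K * B)%N by rewrite leq_pmull.
set a := (X in absz (X - _ + _)); set b := (X in absz (_ - X + _)).
have : (absz a <= K * (2 * B))%N by rewrite /a; case: (i == 0%N).
have : (absz (if i == 0%N then S.[j%:Z] else 0)%R <= B)%N by case: (i == 0%N).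
rewrite -/b in qij; move: qij KB; clearbody a b.
set c := (if _ then _ else _); set t := (K * (2 * B))%N; set t' := (K * B)%N.
by set t'' := (t * n)%N; clearbody c t t' t''; clear; lia.
Qed.

(** The constant of a Gelfond-type inequality for heights of products. The square pays for passing
    from the heights of two factors to their values at a common integer, the last power for bounding
    the value of the product by its height. *)
Definition gelfond n := (((2 * n + 4) ^ n.+1) ^ 2 * n.+1 ^ n.+1)%N.

Lemma absz_horner_leq n (p : {poly int}) j : (size p <= n.+1)%N -> (j <= n)%N ->
  (absz (p.[j%:Z])%R <= n.+1 ^ n.+1 * hgt p)%N.
Proof.
move=> size_p jn; rewrite (horner_coef_wide _ size_p).
apply: leq_trans (absz_sum_leq _ _ _) _.
apply: (@leq_trans (\sum_(i < n.+1) n.+1 ^ n * hgt p)%N); last first.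
  by rewrite sum_nat_const card_ord expnS mulnA.
apply: leq_sum => i _; rewrite abszM mulnC leq_mul ?leq_coef_hgt //.
rewrite abszX absz_nat.
apply: (@leq_trans (n.+1 ^ i)); first by case: {+}(i : nat) => [|k] //; rewrite leq_exp2r // ltnW.
by rewrite leq_pexp2l // -ltnS.
Qed.

(** With [size G] such points, interpolation through them would bound the height of [G] by something
    smaller than itself. *)
Lemma count_small_values n (G : {poly int}) : G != 0 -> (size G <= n.+1)%N ->
  (count (fun j : nat => (2 * n + 4) ^ n.+1 * absz (G.[j%:Z])%R < hgt G)
     (iota 0 n.+1) < size G)%N.
Proof.
move=> nzG sizeG; rewrite ltnNge; apply/negP; rewrite -size_filter.
set bad := fun j : nat => _; set s := [seq _ <- _ | _] => le_s.
set K := ((2 * n + 4) ^ n.+1)%N in bad s le_s *.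
have K_gt0 : (0 < K)%N by rewrite expn_gt0 addnS.
have : (hgt G <= (2 * n + 4) ^ size G * ((hgt G).-1 %/ K))%N.
  apply: (@hgt_interpolation n (size G) G (take (size G) s)).
  - move=> j /mem_take; rewrite mem_filter mem_iota => /and3P[_ _].
    by rewrite add0n ltnS.
  - by rewrite take_uniq // filter_uniq // iota_uniq.
  - by rewrite size_takel.
  - by [].
  - move=> j /mem_take; rewrite mem_filter => /andP[+ _]; rewrite /bad => lt_j.
    by rewrite leq_divRL // mulnC; lia.
apply/negP; rewrite -ltnNge.
apply: (@leq_ltn_trans (K * ((hgt G).-1 %/ K))%N).
  by rewrite leq_mul2r leq_pexp2l ?sizeG ?orbT // addnS.
have := hgt_gt0 G; rewrite nzG => hG; rewrite mulnC.
by apply: leq_ltn_trans (leq_divM _ _) _; lia.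
Qed.

(* Among the points 0..n there are fewer than [size G + size S - 1] ones where
   [G] or [S] is much smaller than its height. *)
Lemma hgt_mul_leq n (G S : {poly int}) : (size G + size S <= n.+2)%N ->
  (hgt G * hgt S <= gelfond n * hgt (G * S))%N.
Proof.
move=> sizeGS.
have [->|nzG] := eqVneq G 0; first by rewrite /hgt size_poly0 big_ord0 mul0n.
have [->|nzS] := eqVneq S 0.
  by rewrite {2}/hgt size_poly0 big_ord0 muln0.
have sG : (0 < size G)%N by rewrite size_poly_gt0.
have sS : (0 < size S)%N by rewrite size_poly_gt0.
have := @count_small_values n G nzG; have := @count_small_values n S nzS.
set K := ((2 * n + 4) ^ n.+1)%N.
set bS := fun j : nat => _; set bG := fun j : nat => _ => cS cG.
have{cS} cS : (count bS (iota 0 n.+1) < size S)%N by apply: cS; lia.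
have{cG} cG : (count bG (iota 0 n.+1) < size G)%N by apply: cG; lia.
have /hasP[j] : has (predC (predU bG bS)) (iota 0 n.+1).
  rewrite has_predC all_count size_iota -(eqn_add2r (count (predI bG bS) (iota 0 n.+1))).
  by rewrite count_predUI; lia.
rewrite mem_iota add0n ltnS /= => jn; rewrite negb_or -!leqNgt => /andP[Gj Sj].
have sizeGS' : (size (G * S)%R <= n.+1)%N by rewrite size_mul // -subn1 leq_subLR add1n.
rewrite /gelfond -mulnA; apply: (@leq_trans (K ^ 2 * absz ((G * S).[j%:Z])%R)%N).
  by rewrite hornerM abszM -mulnn mulnACA leq_mul.
by rewrite leq_mul2l absz_horner_leq ?orbT.
Qed.

(** * Lattice points and maximal determinants *)

Lemma leq_size_inj_in (T : eqType) (U : finType) (A : {pred U}) (f : T -> U)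
    (s : seq T) :
    uniq s -> {in s &, injective f} -> (forall x, x \in s -> f x \in A) ->
  (size s <= #|A|)%N.
Proof.
move=> Us f_inj fA; rewrite -(size_map f).
have Ufs : uniq (map f s) by rewrite map_inj_in_uniq.
rewrite -(card_uniqP Ufs); apply/subset_leq_card/subsetP=> y.
by case/mapP=> x sx ->; apply: fA.
Qed.

Lemma exists_large_fiber (T : eqType) (U : finType) (A : {pred U}) (f : T -> U)
    (s : seq T) :
    s != [::] -> (forall x, x \in s -> f x \in A) ->
  exists y, (size s <= #|A| * count (fun x => f x == y) s)%N.
Proof.
move=> s_nil fA.
have A_gt0 : (0 < #|A|)%N.
  by case: s s_nil fA => // x s _ fA; apply/card_gt0P; exists (f x); rewrite fA ?mem_head.
have [y _ max_y] := eq_bigmax_cond (fun y => count (fun x => f x == y) s) A_gt0.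
exists y; rewrite -max_y -sum_nat_const.
apply: (@leq_trans (\sum_(z in A) count (fun x => f x == z) s)); last first.
  apply: leq_sum => z Az.
  exact: (@leq_bigmax_cond _ (mem A) (fun y => count (fun x => f x == y) s) z Az).
rewrite (eq_bigr (fun z => \sum_(x <- s) (f x == z : nat)))%N; last first.
  by move=> z _; rewrite -sum1_count big_mkcond.
rewrite exchange_big /= -sum1_size big_seq [leqRHS]big_seq.
apply: leq_sum => x sx.
by rewrite (bigD1 (f x)) ?fA //= eqxx.
Qed.

(* The index of the row lattice of [V] is at most [|\det V|] (Smith form). *)
Lemma size_incongruent_leq d (V : 'M[int]_d) (s : seq 'rV[int]_d) :
    \det V != 0 -> uniq s ->
    (forall p q, p \in s -> q \in s -> (exists z, p - q = z *m V) -> p = q) ->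
  (size s <= absz (\det V))%N.
Proof.
move=> nzV Us s_inc.
have [L uL [K uK [e _ defV]]] := int_Smith_normal_form V.
set D := \matrix_(i, j) _ in defV.
have detD : \det D = \prod_(i < d) e`_i.
  rewrite det_trig.
    by apply: eq_bigr => i _; rewrite mxE eqxx.
  by apply/is_trig_mxP=> i j lt_ij; rewrite mxE (_ : (_ == _) = false) ?mulr0n ?ltn_eqF.
have abs_unit n (M : 'M[int]_n) : M \in unitmx -> absz (\det M) = 1%N.
  move/mulmxV/(congr1 (fun M => absz (\det M))).
  by rewrite det_mulmx det1 abszM => /eqP; rewrite muln_eq1 => /andP[/eqP].
have detV : absz (\det V) = (\prod_(i < d) absz (e`_i)%R)%N.
  rewrite defV !det_mulmx !abszM (abs_unit _ L uL) (abs_unit _ K uK) mul1n muln1 detD.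
  exact: (big_morph absz abszM).
have nz_e (i : 'I_d) : e`_i != 0.
  apply: contraNneq nzV => e0; rewrite -absz_eq0 detV.
  by rewrite (bigD1 i) //= e0 mul0n.
(* A common bound, so that the residues modulo all the invariant factors live in one finite type. *)
pose M := (\sum_(i < d) absz (e`_i)%R)%N.
have eM (i : 'I_d) : (absz (e`_i)%R <= M.+1)%N.
  by rewrite /M (bigD1 i) //= leqW ?leq_addr.
(* With [V = L *m D *m K] and [L], [K] unimodular, [p - q] lies in the row lattice of [V] exactly
   when the entries of [(p - q) *m invmx K] are divisible by the diagonal entries of [D]. Hence the
   vector of residues [r p] separates the elements of [s]. *)
pose r (p : 'rV[int]_d) i := ((p *m invmx K) 0%R i %% e`_i)%Z.
have r_ge0 p (i : 'I_d) : 0 <= r p i by apply: modz_ge0.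
have r_lt p (i : 'I_d) : (absz (r p i) < absz (e`_i)%R)%N.
  by rewrite -ltz_nat gez0_abs ?r_ge0 // abszE ltz_mod.
pose f (p : 'rV[int]_d) : {ffun 'I_d -> 'I_M.+1} := [ffun i => inord (absz (r p i))].
have fE p i : f p i = absz (r p i) :> nat.
  by rewrite ffunE inordK // (leq_trans (r_lt _ _)).
pose A := family (fun i : 'I_d => [pred x : 'I_M.+1 | (x < absz (e`_i)%R)%N]).
apply: (@leq_trans #|A|).
  apply: (leq_size_inj_in Us (f := f)) => [p q sp sq eq_f|p _]; last first.
    by apply/familyP=> i; rewrite inE fE.
  apply: s_inc => //.
  pose y : 'rV_d := \row_i (((p - q) *m invmx K) 0%R i %/ e`_i)%Z.
  exists (y *m invmx L); rewrite defV !mulmxA mulmxKV //.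
  suff <- : (p - q) *m invmx K = y *m D by rewrite mulmxKV.
  apply/rowP=> i; rewrite [RHS]mxE (bigD1 i) //= big1 => [|j ne_ji]; last first.
    by rewrite [D _ _]mxE (_ : (_ == _) = false) ?mulr0n ?mulr0 //; apply/negbTE.
  rewrite [D _ _]mxE eqxx mulr1n [y _ _]mxE addr0 divzK //.
  rewrite mulmxBl (_ : forall a b : 'rV_d, (a - b) 0 i = a 0 i - b 0 i) => [|a b]; last by rewrite !mxE.
  rewrite -eqz_mod_dvd; apply/eqP.
  have : f p i = f q i :> nat by rewrite eq_f.
  by rewrite !fE => /(congr1 Posz); rewrite !gez0_abs // /r => ->.
rewrite card_family detV foldrE big_map big_enum /=.
apply: leq_prod => i _.
have e_gt0 : (0 < absz (e`_i)%R)%N by rewrite absz_gt0.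
rewrite -[leqRHS](prednK e_gt0) -[leqRHS]card_ord cardE.
apply: (leq_size_inj_in (f := fun x : 'I_M.+1 => inord x)) => //.
  exact: enum_uniq.
move=> x y; rewrite !mem_enum => lt_x lt_y /(congr1 val).
by rewrite /= !inordK ?prednK // => /val_inj.
Qed.

Definition row_repl d (V : 'M[int]_d) (i : 'I_d) (v : 'rV[int]_d) : 'M[int]_d :=
  \matrix_(i', j) if i' == i then v 0 j else V i' j.

(** Expansion along the replaced row, whose cofactors are those of [V]. This is Cramer's rule:
    divided by [\det V], it gives the coordinate of [v] along row [i] of [V]. *)
Lemma det_row_repl d (V : 'M[int]_d) i v :
  \det (row_repl V i v) = (v *m \adj V) 0 i.
Proof.
rewrite (expand_det_row _ i) [RHS]mxE; apply: eq_bigr => j _.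
rewrite [\adj V j i]mxE mxE eqxx; congr (_ * (_ * \det _)).
by apply/matrixP=> k l; rewrite !mxE eq_sym (negbTE (neq_lift _ _)).
Qed.

Lemma row_row_repl d (V : 'M[int]_d) i v i' :
  row i' (row_repl V i v) = if i' == i then v else row i' V.
Proof.
by apply/rowP=> j; rewrite !mxE; case: eqP => // _; rewrite mxE.
Qed.

(* By Cramer's rule and maximality each element of [T] has coordinates in [-1, 1]
   with respect to the rows of [V]; three cells of length < 1 per coordinate
   separate the congruent ones. *)
Lemma size_leq_max_det d (T : 'rV[int]_d -> Prop) (V : 'M[int]_d) (s : seq 'rV[int]_d) :
    (forall i, T (row i V)) -> \det V != 0 ->
    (forall V' : 'M[int]_d, (forall i, T (row i V')) -> (absz (\det V') <= absz (\det V))%N) ->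
    uniq s -> (forall p, p \in s -> T p) ->
  (size s <= 3 ^ d * absz (\det V))%N.
Proof.
move=> TV nzV maxV Us Ts.
have [->//|s_nil] := eqVneq s [::].
set D := absz (\det V) in maxV *.
have D_gt0 : (0 < D)%N by rewrite absz_gt0.
have adjT p i : T p -> (absz ((p *m \adj V) 0 i)%R <= D)%N.
  move=> Tp; rewrite -det_row_repl; apply: maxV => i'.
  by rewrite row_row_repl; case: eqP.
(* The coordinate lies in [-1, 1]; adding [1], that is [D] in the numerator, makes it nonnegative,
   and its integer part is then 0, 1 or 2. *)
pose cell (p : 'rV[int]_d) i := (absz ((p *m \adj V) 0 i + D%:Z)%R %/ D)%N.
pose f (p : 'rV[int]_d) : {ffun 'I_d -> 'I_3} := [ffun i => inord (cell p i)].
have [y] := @exists_large_fiber _ _ predT f s s_nil (fun _ _ => isT).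
rewrite card_ffun !card_ord -size_filter => /leq_trans-> //.
rewrite leq_mul2l; apply/orP; right.
apply: size_incongruent_leq; rewrite ?filter_uniq // => p q.
rewrite !mem_filter => /andP[/eqP fp sp] /andP[/eqP fq sq] [z pqz].
have defz i : (p *m \adj V) 0 i - (q *m \adj V) 0 i = z 0 i * \det V.
  have := congr1 (fun u => (u *m \adj V) 0 i) pqz.
  by rewrite mulmxBl -mulmxA mul_mx_adj mul_mx_scalar !mxE mulrC.
suff z0 : z = 0 by apply/eqP; rewrite -subr_eq0 pqz z0 mul0mx.
apply/rowP=> i; rewrite mxE; apply/eqP/negPn/negP => nz_z.
have pD := adjT _ i (Ts _ sp); have qD := adjT _ i (Ts _ sq).
have cell3 u : (absz ((u *m \adj V) 0 i)%R <= D)%N -> (cell u i < 3)%N.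
  by rewrite /cell ltn_divLR //; move: (_ 0 i) D_gt0; clear; lia.
have : f p i = f q i :> nat by rewrite fp fq.
rewrite !ffunE !inordK ?cell3 // /cell => eq_cell.
(* Congruent points have coordinates differing by integers. A nonzero difference would separate the
   numerators by at least [D], which is impossible within one cell. *)
have : (D <= absz (z 0%R i * \det V)%R)%N by rewrite abszM leq_pmull // absz_gt0.
rewrite -defz; move: eq_cell pD qD.
set a := (p *m _) 0 i; set b := (q *m _) 0 i => eq_cell aD bD.
have := divn_eq (absz (a + D%:Z)%R) D; have := divn_eq (absz (b + D%:Z)%R) D.
have := ltn_pmod (absz (a + D%:Z)%R) D_gt0; have := ltn_pmod (absz (b + D%:Z)%R) D_gt0.
rewrite eq_cell; set t := (_ %/ _ * _)%N; set u := (_ %% _)%N; set w := (_ %% _)%N.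
by clearbody a b t u w D; move: aD bD D_gt0; clear; lia.
Qed.

(** * Degrees in additive groups of polynomials *)

Definition zclosed (W : {poly int} -> Prop) :=
  W 0 /\ forall a p w, W p -> W w -> W (a *: p + w).

Lemma zclosedZ W a p : zclosed W -> W p -> W (a *: p).
Proof. by case=> W0 WD Wp; rewrite -[_ *: _]addr0; apply: WD. Qed.

Lemma zclosedB W p w : zclosed W -> W p -> W w -> W (p - w).
Proof. by case=> _ WD Wp Ww; rewrite addrC -scaleN1r; apply: WD. Qed.

Inductive zspan (B : {poly int} -> Prop) : {poly int} -> Prop :=
| zspan0 : zspan B 0
| zspan_cons a p w : B p -> zspan B w -> zspan B (a *: p + w).

Lemma zspan_gen B p : B p -> zspan B p.
Proof.
by move=> Bp; rewrite -[p]addr0 -[p in p + _]scale1r; apply: zspan_cons => //; apply: zspan0.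
Qed.

Lemma zclosed_zspan B : zclosed (zspan B).
Proof.
split=> [|a p w Bp Bw]; first exact: zspan0.
elim: Bp => [|b p' w' Bp' _ IH]; first by rewrite scaler0 add0r.
by rewrite scalerDr scalerA -addrA; apply: zspan_cons.
Qed.

Lemma zspan_ind_closed B (W : {poly int} -> Prop) :
  zclosed W -> (forall p, B p -> W p) -> forall p, zspan B p -> W p.
Proof. by case=> W0 WD BW p; elim=> // a p' w' /BW Wp' _ Ww'; apply: WD. Qed.

(** For a subgroup of polynomials of degree at most [n], the number of degrees that occur is its
    rank; this cardinal plays the role of the dimension. *)
Definition degrees n (W : {poly int} -> Prop) : {set 'I_n.+1} :=
  [set e : 'I_n.+1 | `[< exists2 w, W w & size w = e.+1 >]].

Lemma degreesP n (W : {poly int} -> Prop) (e : 'I_n.+1) :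
  reflect (exists2 w : {poly int}, W w & size w = e.+1) (e \in degrees n W).
Proof. by rewrite inE; apply: asboolP. Qed.

(* An element of [W] is determined by its coefficients in the degrees occurring
   in [W]. *)
Lemma size_leq_degrees n (W : {poly int} -> Prop) h (s : seq {poly int}) :
    zclosed W -> (forall w, W w -> (size w <= n.+1)%N) -> uniq s ->
    (forall p, p \in s -> W p /\ (hgt p <= h)%N) ->
  (size s <= (2 * h).+1 ^ #|degrees n W|)%N.
Proof.
move=> cW Wn Us sW.
pose f (p : {poly int}) : {ffun 'I_n.+1 -> 'I_(2 * h).+1} :=
  [ffun e => if e \in degrees n W then inord (absz (p`_e + h%:Z)%R) else ord0].
rewrite -[X in (X ^ _)%N]card_ord.
rewrite -(card_pffun_on ord0 (mem (degrees n W)) (mem predT)).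
apply: (leq_size_inj_in (f := f)) => // [p q sp sq eq_f|p sp]; last first.
  apply/pffun_onP; split=> //; apply/supportP=> e We.
  by rewrite ffunE (negbTE We).
have [Wp hp] := sW _ sp; have [Wq hq] := sW _ sq.
apply/eqP; rewrite -subr_eq0; apply/negPn/negP => nz.
have sz := Wn _ (zclosedB cW Wp Wq); have sz0 : (0 < size (p - q)%R)%N by rewrite size_poly_gt0.
have lt_e : ((size (p - q)%R).-1 < n.+1)%N by rewrite prednK.
have De : Ordinal lt_e \in degrees n W.
  by apply/degreesP; exists (p - q); rewrite ?prednK //; apply: zclosedB.
have : f p (Ordinal lt_e) = f q (Ordinal lt_e) :> nat by rewrite eq_f.
have hgt_e r : (hgt r <= h)%N -> (absz (r`_(size (p - q)%R).-1)%R <= h)%N.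
  exact: leq_trans (leq_coef_hgt _ _).
move: (hgt_e p hp) (hgt_e q hq); rewrite !ffunE De => pe qe.
rewrite !inordK; last first.
- by move: (_`_ _) pe; clear; lia.
- by move: (_`_ _) qe; clear; lia.
rewrite /= => eq_pq; move: nz; rewrite -lead_coef_eq0 lead_coefE coefB.
by move: (p`_ _) (q`_ _) pe qe eq_pq; clear; lia.
Qed.

(** Division without fractions: cross-multiply by leading coefficients to cancel the top term of [y]
    against an element of [W] of the same degree, then recurse on the remainder, which is again in
    [W']. The multiplier [m] collects the leading coefficients used. *)
Lemma zclosed_reduce (W W' : {poly int} -> Prop) N :
    zclosed W -> zclosed W' -> (forall w, W w -> W' w) ->
    (forall w, W' w -> w != 0 -> (size w <= N)%N ->
       exists2 w', W w' & size w' = size w) ->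
  forall y, W' y -> (size y <= N)%N -> exists2 m, m != 0 & W (m *: y).
Proof.
move=> cW cW' sub hN y; have [k] := ubnP (size y).
elim: k y => // k IHk y; rewrite ltnS => le_k W'y yN.
have [->|nzy] := eqVneq y 0.
  by exists 1; rewrite ?scaler0 //; case: cW.
have [w Ww sz] := hN _ W'y nzy yN.
have nzw : w != 0 by rewrite -size_poly_gt0 sz size_poly_gt0.
pose z := lead_coef w *: y - lead_coef y *: w.
have W'z : W' z by apply: zclosedB => //; apply: zclosedZ => //; apply: sub.
have szz : (size z < size y)%N.
  rewrite -[leqRHS]prednK ?size_poly_gt0 // ltnS; apply/leq_sizeP=> j.
  rewrite leq_eqVlt => /orP[/eqP <-|lt_j]; rewrite coefB !coefZ.
    by rewrite -[in w`__]sz -!lead_coefE mulrC subrr.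
  have ge_j : (size y <= j)%N by rewrite -[size y]prednK ?size_poly_gt0.
  by rewrite !nth_default ?sz // !mulr0 subrr.
have [||m nzm Wmz] := IHk z _ W'z; [exact: leq_trans le_k | exact: leq_trans (ltnW szz) yN |].
exists (m * lead_coef w); first by rewrite mulf_neq0 ?lead_coef_eq0.
have -> : (m * lead_coef w) *: y = (m * lead_coef y) *: w + m *: z.
  by rewrite /z scalerBr !scalerA addrCA subrr addr0.
by case: cW => _; apply.
Qed.

(* The set of degrees of [W'] contains that of [W] and its largest element plus
   one, hence equals their union; being stable under successors below its
   maximum, the set of degrees of [W] is an interval. *)
Lemma stable_degrees_dvdp n (W W' : {poly int} -> Prop) :
    zclosed W -> zclosed W' -> (forall w, W w -> W' w) ->
    (forall w, W w -> W' (w * 'X)) -> (forall w, W' w -> (size w <= n.+1)%N) ->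
    (0 < #|degrees n W|)%N -> (#|degrees n W'| <= #|degrees n W|.+1)%N ->
  exists (A : {poly int}) (g d : nat), [/\ size A = g.+1, (0 < d)%N,
    forall j, (j < d)%N -> exists2 w : {poly int}, W w & size w = (g + j).+1,
    forall w, W w -> (size w <= g + d)%N &
    forall w : {poly int}, W w -> A %| w].
Proof.
move=> cW cW' sub mulX Wn' D_gt0 leD.
pose D e := `[< exists2 w : {poly int}, W w & size w = e.+1 >].
have DP e : reflect (exists2 w : {poly int}, W w & size w = e.+1) (D e) by apply: asboolP.
have exD : exists e, D e.
  by case/card_gt0P: D_gt0 => e /degreesP De; exists e; apply/DP.
have Dn e : D e -> (e < n)%N.
  case/DP=> w Ww sz; have := Wn' _ (mulX _ Ww).
  by rewrite size_mulX -?size_poly_gt0 sz // !ltnS.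
have [g /DP[A WA sA] min_g] := ex_minnP exD.
have [M DM max_M] := ex_maxnP exD (fun e h => ltnW (Dn e h)).
have le_gM : (g <= M)%N by apply: min_g.
have sW w : W w -> w != 0 -> (g < size w <= M.+1)%N.
  move=> Ww nzw; rewrite -[size w]prednK ?size_poly_gt0 // !ltnS.
  have Dw : D (size w).-1 by apply/DP; exists w; rewrite ?prednK ?size_poly_gt0.
  by rewrite min_g // max_M.
have [vM WvM sM] := DP _ DM.
have lt_Mn : (M.+1 < n.+1)%N by rewrite ltnS Dn.
pose M1 := Ordinal lt_Mn.
have M1D : M1 \notin degrees n W.
  apply/negP=> /degreesP[w Ww /= sw].
  have : D M.+1 by apply/DP; exists w.
  by move/max_M; rewrite ltnn.
have subD : M1 |: degrees n W \subset degrees n W'.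
  apply/subsetP=> e; rewrite in_setU1 => /orP[/eqP->|/degreesP[w Ww sw]].
    apply/degreesP; exists (vM * 'X); first exact: mulX.
    by rewrite size_mulX -?size_poly_gt0 sM.
  by apply/degreesP; exists w => //; apply: sub.
(* The right side already has one element more than [degrees n W], which is all that the cardinality
   hypothesis allows. *)
have eqD : degrees n W' = M1 |: degrees n W.
  by apply/esym/eqP; rewrite eqEcard subD cardsU1 M1D add1n.
have W'D (w : {poly int}) : W' w -> w != 0 -> (size w <= M.+1)%N -> D (size w).-1.
  move=> W'w nzw le_w; have sw : (0 < size w)%N by rewrite size_poly_gt0.
  have lt_w : ((size w).-1 < n.+1)%N by rewrite prednK // Wn'.
  have : Ordinal lt_w \in degrees n W' by apply/degreesP; exists w; rewrite ?prednK.
  rewrite eqD in_setU1 => /orP[/eqP/(congr1 val) /= eq_M|].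
    by move: le_w; rewrite -[size w]prednK // eq_M ltnn.
  by case/degreesP=> v Wv sv; apply/DP; exists v.
have W'W (w : {poly int}) : W' w -> w != 0 -> (size w <= M.+1)%N ->
    exists2 v : {poly int}, W v & size v = size w.
  move=> W'w nzw le_w; have /DP[v Wv sv] := W'D w W'w nzw le_w.
  by exists v; rewrite // sv prednK // size_poly_gt0.
(* From a multiple of [A] in [W] of degree [g + j], multiplication by ['X] leads into [W']. Up to
   degree [M], [W'] has no degrees beyond those of [W], so a nonzero scalar brings the product back
   into [W]. *)
have Aj j : (g + j <= M)%N ->
    exists w : {poly int}, [/\ W w, size w = (g + j).+1 & A %| w].
  elim: j => [|j IHj] le_j; first by exists A; rewrite addn0 dvdpp.
  have [|w [Ww sw Aw]] := IHj; first by rewrite (leq_trans _ le_j) // leq_add2l.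
  have swX : size (w * 'X) = (g + j.+1).+1.
    by rewrite size_mulX -?size_poly_gt0 sw // addnS.
  have [|m nzm Wm] := zclosed_reduce cW cW' sub W'W (mulX _ Ww); first by rewrite swX.
  by exists (m *: (w * 'X)); split; rewrite ?size_scale // dvdpZr // dvdp_mulr.
exists A, g, (M - g).+1; split=> // [j|w Ww|w Ww].
- by rewrite ltnS => le_j; have [|w [Ww sw _]] := Aj j; [lia | exists w].
- have [->|nzw] := eqVneq w 0; first by rewrite size_poly0.
  by rewrite addnS subnKC //; case/andP: (sW _ Ww nzw).
have [->|nzw] := eqVneq w 0; first by rewrite dvdp0.
pose V (v : {poly int}) := W v /\ A %| v.
have cV : zclosed V.
  case: (cW) => W0 WD; split=> [|a p v [Wp Ap] [Wv Av]]; first by split; rewrite ?dvdp0.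
  by split; [apply: WD | rewrite dvdp_add // -mul_polyC dvdp_mull].
have VW v : V v -> W v by case.
have WV v : W v -> v != 0 -> (size v <= M.+1)%N ->
    exists2 v' : {poly int}, V v' & size v' = size v.
  move=> Wv nzv le_v; have /andP[gt_g _] := sW _ Wv nzv.
  have [|v' [Wv' sv' Av']] := Aj (size v - g.+1)%N; first by lia.
  by exists v'; rewrite // sv' -addSn subnKC.
have [|m nzm [_]] := zclosed_reduce cV cW VW WV Ww; last by rewrite dvdpZr.
by case/andP: (sW _ Ww nzw).
Qed.

(** * Determinants and resultants *)

(** The Leibniz formula. Bounds may vary from entry to entry, so that a column of small values can
    be treated apart. *)
Lemma det_norm_leq (R : realDomainType) n (A : 'M[R]_n) (B : 'I_n -> 'I_n -> R) T :
    (forall i j, `|A i j| <= B i j) ->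
    (forall s : 'S_n, \prod_i B i (s i) <= T) ->
  `|\det A| <= n`!%:R * T.
Proof.
move=> AB BT; apply: le_trans (ler_norm_sum _ _ _) _.
rewrite -card_Sn mulr_natl -sumr_const [leRHS](eq_bigl xpredT) //; apply: ler_sum => s _.
rewrite normrM normrX normrN normr1 expr1n mul1r normr_prod.
apply: le_trans (BT s).
by apply: ler_prod => i _; rewrite normr_ge0 AB.
Qed.

(* The first column may be replaced by the values at [x] of the polynomials whose
   coefficients are the rows. *)
Lemma det_horner_leq (R : realFieldType) n (A : 'M[R]_n) x (y z : 'I_n -> R) T :
    (0 < n)%N -> (forall i j, `|A i j| <= y i) ->
    (forall i, `|\sum_j A i j * x ^+ j| <= z i) ->
    (forall i, z i * \prod_(k | k != i) y k <= T) ->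
  `|\det A| <= n`!%:R * T.
Proof.
case: n A y z => // n A y z _ Ay Az zT.
(* Unit lower triangular: [A *m U] differs from [A] only in its first column, which becomes the
   column of values at [x]. *)
pose U : 'M[R]_n.+1 := \matrix_(k, j) if j == 0 then x ^+ k else (k == j)%:R.
have detU : \det U = 1.
  rewrite det_trig.
    by rewrite big1 // => i _; rewrite mxE; case: eqP => [->|_] //; rewrite eqxx.
  apply/is_trig_mxP=> i j lt_ij; rewrite mxE.
  have -> : (j == 0) = false by apply/negbTE; rewrite -val_eqE /=; case: (j : nat) lt_ij.
  by have -> : (i == j) = false by apply: ltn_eqF.
have -> : \det A = \det (A *m U) by rewrite det_mulmx detU mulr1.
pose B (i j : 'I_n.+1) := if j == 0 then z i else y i.
apply: (det_norm_leq (B := B)) => [i j|s].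
  rewrite /B !mxE; case: eqP => [->|/eqP nz_j].
    by under eq_bigr do rewrite mxE eqxx; apply: Az.
  rewrite (bigD1 j) //= big1 ?addr0 => [|k ne_kj].
    by rewrite mxE (negbTE nz_j) eqxx mulr1.
  by rewrite mxE (negbTE nz_j) (negbTE ne_kj) mulr0.
rewrite (bigD1 (s^-1 0)%g) //= permKV {1}/B eqxx.
rewrite (eq_bigr y) // => i ne_i; rewrite /B ifN //.
by apply: contraNneq ne_i => <-; rewrite permK.
Qed.

(** Steinitz exchange. Elements of the span of degrees [0] to [d - 1] give a triangular matrix with
    nonzero determinant; its rows are then replaced one by one by elements of [T] itself. *)
Lemma exists_det_neq0 d (T : {poly int} -> Prop) :
    (forall j, (j < d)%N -> exists2 w : {poly int}, zspan T w & size w = j.+1) ->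
  exists2 V : 'M[int]_d, (forall i, exists2 p, T p & row i V = poly_rV p) & \det V != 0.
Proof.
move=> Tj.
suff H k : (k <= d)%N -> exists2 V : 'M[int]_d, forall i : 'I_d,
    (exists2 p, T p & row i V = poly_rV p) \/
      (k <= i)%N /\ exists2 p, zspan T p & row i V = poly_rV p & \det V != 0.
  have [V TV nzV] := H d (leqnn d); exists V => // i.
  by case: (TV i) => // -[]; rewrite leqNgt ltn_ord.
elim: k => [_|k IHk lt_k].
  have /choice[w Tw] (j : 'I_d) : exists w : {poly int}, zspan T w /\ size w = j.+1.
    by have [w] := Tj _ (ltn_ord j); exists w.
  exists (\matrix_i poly_rV (w i)) => [i|].
    by right; split=> //; exists (w i); [case: (Tw i) | rewrite rowK].
  rewrite det_trig.
    apply/prodf_neq0=> i _; rewrite !mxE; have [_ sw] := Tw i.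
    by rewrite -[i : nat]/(i.+1.-1) -sw -lead_coefE lead_coef_eq0 -size_poly_gt0 sw.
  apply/is_trig_mxP=> i j lt_ij; rewrite !mxE nth_default //.
  by have [_ ->] := Tw i.
have [V TV nzV] := IHk (ltnW lt_k).
(* [phi p] is the determinant with row [k'] replaced by [p]. It is linear in [p], so if it vanished
   on [T] it would vanish on the span, hence on the present row, where it equals [\det V]. *)
pose k' := Ordinal lt_k; pose phi (p : {poly int}) := (poly_rV p *m \adj V) 0 k'.
have phiV : (row k' V *m \adj V) 0 k' = \det V.
  by rewrite -row_mul mul_mx_adj !mxE eqxx.
have [p Tp nz_phi] : exists2 p, T p & phi p != 0.
  apply: contrapT => noT; have {}noT p : T p -> phi p = 0.
    by move=> Tp; apply/eqP/negPn/negP => nz; apply: noT; exists p.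
  have [q Tq defq] : exists2 q, zspan T q & row k' V = poly_rV q.
    by case: (TV k') => [[q Tq ->]|[]//]; exists q => //; apply: zspan_gen.
  move: nzV; rewrite -phiV defq => /eqP[].
  have cphi : zclosed (fun p => phi p = 0).
    split=> [|a u w phi_u phi_w]; first by rewrite /phi linear0 mul0mx mxE.
    by rewrite /phi linearP mulmxDl -scalemxAl mxE [X in X + _]mxE -!/(phi _) phi_u phi_w mulr0 addr0.
  exact: (zspan_ind_closed cphi noT).
exists (row_repl V k' (poly_rV p)); last by rewrite det_row_repl.
move=> i; rewrite row_row_repl; case: eqP => [->|/eqP ne_i]; first by left; exists p.
case: (TV i) => [|[le_ki]]; first by left.
by right; split=> //; rewrite ltn_neqAle le_ki andbT eq_sym.
Qed.

(** The bound on heights bounds the determinants formed from [T], so a maximal one exists, and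
    [size_leq_max_det] applies to the vectors of coefficients. *)
Lemma size_leq_exists_det d h (T : {poly int} -> Prop) (s : seq {poly int}) :
    (forall j, (j < d)%N -> exists2 w : {poly int}, zspan T w & size w = j.+1) ->
    (forall p, T p -> (size p <= d)%N /\ (hgt p <= h)%N) ->
    uniq s -> (forall p, p \in s -> T p) ->
  exists V : 'M[int]_d, [/\ forall i, exists2 p, T p & row i V = poly_rV p, \det V != 0 &
    (size s <= 3 ^ d * absz (\det V))%N].
Proof.
move=> Tj Tb Us sT.
pose TV (V : 'M[int]_d) := forall i, exists2 p, T p & row i V = poly_rV p.
pose P m := `[< exists2 V, TV V & absz (\det V) = m >].
have exP : exists m, P m.
  by have [V VT _] := exists_det_neq0 Tj; exists (absz (\det V)); apply/asboolP; exists V.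
have maxP m : P m -> (m <= d`! * h ^ d)%N.
  case/asboolP=> V VT <-; rewrite -lez_nat abszE PoszM -natz.
  apply: (det_norm_leq (B := fun _ _ => h%:Z)) => [i j|s'].
    have [p Tp /rowP/(_ j)] := VT i; rewrite !mxE => ->.
    rewrite -abszE lez_nat; apply: leq_trans (leq_coef_hgt _ _) _.
    by case: (Tb p Tp).
  by rewrite prodr_const card_ord -[h%:Z]natz -[(h ^ d)%N%:Z]natz natrX.
have [m /asboolP[V VT detV] maxm] := ex_maxnP exP maxP.
exists V.
have maxV V' : TV V' -> (absz (\det V') <= absz (\det V))%N.
  by move=> V'T; rewrite detV; apply: maxm; apply/asboolP; exists V'.
have nzV : \det V != 0.
  have [V' V'T nzV'] := exists_det_neq0 Tj.
  by rewrite -absz_gt0 (leq_trans _ (maxV _ V'T)) // absz_gt0.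
split=> //; pose T' (v : 'rV[int]_d) := exists2 p, T p & v = poly_rV p.
have inj : {in s &, injective (poly_rV : {poly int} -> 'rV[int]_d)}.
  move=> p q /sT Tp /sT Tq /(congr1 rVpoly).
  by rewrite !poly_rV_K //; [case: (Tb q Tq) | case: (Tb p Tp)].
rewrite -(size_map (poly_rV : {poly int} -> 'rV[int]_d)).
apply: (@size_leq_max_det d T') => //; first by rewrite map_inj_in_uniq.
by move=> v /mapP[p /sT Tp ->]; exists p.
Qed.

Definition ev (R : realFieldType) (x : R) (p : {poly int}) : R :=
  (map_poly intr p).[x].

Lemma evM (R : realFieldType) (x : R) p q : ev x (p * q) = ev x p * ev x q.
Proof. by rewrite /ev rmorphM hornerM. Qed.

Lemma evB (R : realFieldType) (x : R) p q : ev x (p - q) = ev x p - ev x q.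
Proof. by rewrite /ev rmorphB hornerD hornerN. Qed.

Lemma evX (R : realFieldType) (x : R) : ev x 'X = x.
Proof. by rewrite /ev map_polyX hornerX. Qed.

Lemma ev_coef_wide (R : realFieldType) (x : R) m (p : {poly int}) :
  (size p <= m)%N -> ev x p = \sum_(j < m) (p`_j)%:~R * x ^+ j.
Proof.
move=> pm; rewrite /ev (@horner_coef_wide _ m) ?size_map_inj_poly //.
- by apply: eq_bigr => j _; rewrite coef_map.
- exact: intr_inj.
Qed.

(** A nonzero resultant is an integer, hence at least [1] in absolute value. The rows of the
    Sylvester matrix are the polynomials [P * 'X^k] and [G * 'X^k]; as [|x| <= 1], their values at
    [x] are at most [X] and [Y], and [det_horner_leq] applies. *)
Lemma resultant_geq1 (R : realFieldType) (x : R) n g (P G : {poly int}) (q H : nat) X Y :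
    (0 < n)%N -> (0 < g)%N -> `|x| <= 1 -> size P = n.+1 -> size G = g.+1 ->
    resultant P G != 0 ->
    (hgt P <= q)%N -> (hgt G <= H)%N -> `|ev x P| <= X -> `|ev x G| <= Y ->
  1 <= (n + g)`!%:R * (X * q%:R ^+ g.-1 * H%:R ^+ n + Y * q%:R ^+ g * H%:R ^+ n.-1).
Proof.
move=> n_gt0 g_gt0 x1 sP sG nzR Pq GH PX GY.
have nzP : P != 0 by rewrite -size_poly_gt0 sP.
have nzG : G != 0 by rewrite -size_poly_gt0 sG.
have q_gt0 : (0 < q%:R :> R) by rewrite ltr0n (leq_trans _ Pq) // hgt_gt0.
have H_gt0 : (0 < H%:R :> R) by rewrite ltr0n (leq_trans _ GH) // hgt_gt0.
have X_ge0 : 0 <= X by apply: le_trans PX.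
have Y_ge0 : 0 <= Y by apply: le_trans GY.
have -> : (n + g)`!%:R = ((size G).-1 + (size P).-1)`!%:R :> R by rewrite sP sG addnC.
pose A : 'M[R]_((size G).-1 + (size P).-1) := map_mx intr (Sylvester_mx P G).
have detA : 1 <= `|\det A|.
  rewrite det_map_mx -intr_norm; rewrite -[1]/(1%:~R) ler_int.
  by rewrite -gtz0_ge1 normr_gt0.
apply: le_trans detA _.
(* The rows in the first block, [(size G).-1] in number, come from [P]; the other [(size P).-1] rows
   come from [G]. *)
pose y i : R := match @split (size G).-1 (size P).-1 i with inl _ => q%:R | inr _ => H%:R end.
pose z i : R := match @split (size G).-1 (size P).-1 i with inl _ => X | inr _ => Y end.
have coefS (r : {poly int}) h k j : (hgt r <= h)%N ->
    `|((r`_(j - k) *+ (k <= j)%N)%:~R : R)| <= h%:R.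
  move=> rh; rewrite -intr_norm -abszE -[h%:R]/(h%:Z%:~R) ler_int lez_nat.
  case: (k <= j)%N => //=.
  exact: leq_trans (leq_coef_hgt _ _) rh.
have sumS (r : {poly int}) k (m := ((size G).-1 + (size P).-1)%N) Z : r != 0 ->
    (size r + k <= m)%N -> `|ev x r| <= Z ->
    `|\sum_(j < m) (r`_(j - k) *+ (k <= j)%N)%:~R * x ^+ j| <= Z.
  move=> nzr rk rZ.
  rewrite (_ : \sum_(j < m) _ = ev x (r * 'X^k)); last first.
    rewrite (@ev_coef_wide _ _ m); last first.
      by rewrite size_mulXn // addnC.
    by apply: eq_bigr => j _; rewrite coefMXn; case: ltnP => //=; rewrite mulr0n.
  rewrite evM /ev rmorphXn /= map_polyX hornerXn normrM normrX.
  by apply: le_trans rZ; rewrite ler_piMr // exprn_ile1.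
apply: (det_horner_leq (y := y) (z := z) (x := x)).
- by rewrite sP sG addn_gt0 g_gt0.
- move=> i j; rewrite mxE Sylvester_mxE /y; case: split => k; exact: coefS.
- move=> i; rewrite /z.
  under eq_bigr do rewrite mxE Sylvester_mxE.
  case: split => k; apply: sumS => //.
    have := ltn_ord k; move: (k : nat) => k'; rewrite sP sG /= => lt_k.
    by rewrite addSnnS addnC leq_add2r.
  have := ltn_ord k; move: (k : nat) => k'; rewrite sP sG /= => lt_k.
  by rewrite addSnnS leq_add2l.
move=> i.
have prodY : \prod_k y k = q%:R ^+ g * H%:R ^+ n.
  rewrite big_split_ord /=; congr (_ * _).
    rewrite (eq_bigr (fun _ => q%:R)) ?prodr_const ?card_ord ?sG // => k _.
    by rewrite /y (unsplitK (inl k)).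
  rewrite (eq_bigr (fun _ => H%:R)) ?prodr_const ?card_ord ?sP // => k _.
  by rewrite /y (unsplitK (inr k)).
have y_gt0 : 0 < y i by rewrite /y; case: split.
have -> : \prod_(k | k != i) y k = (q%:R ^+ g * H%:R ^+ n) / y i.
  by rewrite -prodY [in RHS](bigD1 i) //= mulrAC divff ?mul1r // gt_eqF.
(* Evaluating a row of [P] gives the first term of the sum, evaluating a row of [G] the second; the
   remaining term is nonnegative. *)
rewrite /z /y; case: split => k.
  rewrite -[in q%:R ^+ g](prednK g_gt0) exprS.
  rewrite [leLHS](_ : _ = X * q%:R ^+ g.-1 * H%:R ^+ n); last first.
    by move: (_ ^+ _) (_ ^+ _) => a b; field; rewrite gt_eqF.
  by rewrite lerDl ?mulr_ge0 ?exprn_ge0 ?ler0n.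
rewrite -[in H%:R ^+ n](prednK n_gt0) exprS.
rewrite [leLHS](_ : _ = Y * q%:R ^+ g * H%:R ^+ n.-1); last first.
  by move: (_ ^+ _) (_ ^+ _) => a b; field; rewrite gt_eqF.
by rewrite lerDr ?mulr_ge0 ?exprn_ge0 ?ler0n.
Qed.

(** By Gauss's lemma the primitive part of the gcd divides [P] over the integers. By irreducibility
    the gcd is constant or has the degree of [P], and the latter exceeds the degree of [G]. *)
Lemma irreducible_resultant_neq0 (P G : {poly int}) :
  irreducibleZ P -> G != 0 -> (size G < size P)%N -> resultant P G != 0.
Proof.
move=> [nzP [uP irrP]] nzG lt_GP; rewrite resultant_eq0 -leqNgt.
have [r defP] := dvdpP_int (dvdp_gcdl P G).
have unit_size p : p \is a GRing.unit -> size (p : {poly int}) = 1%N.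
  by rewrite poly_unitE => /andP[/eqP].
have nzD : gcdp P G != 0 by rewrite gcdp_eq0 negb_and nzP.
have [/unit_size|/unit_size sr] := irrP _ _ defP.
  by rewrite size_zprimitive => ->.
have nzr : r != 0 by rewrite -size_poly_gt0 sr.
have sP : size P = size (gcdp P G).
  by rewrite {1}defP size_mul ?zprimitive_eq0 // sr addn1 size_zprimitive.
by move: lt_GP; rewrite sP ltnNge dvdp_leq // dvdp_gcdr.
Qed.

(** * Polynomials that are small at a point *)

(** Pigeonhole on the [n - r] coefficients above degree [r], each with at most [2 * q + 1] values.
    Subtracting one member of the largest class from all of them removes these coefficients and at
    most doubles heights and values. *)
Lemma exists_common_top (R : realFieldType) (x X : R) n r q (l : seq {poly int}) :
    (r <= n)%N -> uniq l ->
    (forall P, P \in l -> [/\ (size P <= n.+1)%N, (hgt P <= q)%N & `|ev x P| <= X]) ->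
  exists L : seq {poly int}, [/\ uniq L,
    forall p, p \in L -> [/\ (size p <= r.+1)%N, (hgt p <= 2 * q)%N & `|ev x p| <= 2 * X] &
    (size l <= (2 * q).+1 ^ (n - r) * size L)%N].
Proof.
move=> rn Ul lP; have [->|l_nil] := eqVneq l [::]; first by exists [::].
pose f (P : {poly int}) : {ffun 'I_(n - r) -> 'I_(2 * q).+1} :=
  [ffun e : 'I_(n - r) => inord (absz (P`_(r.+1 + e) + q%:Z)%R)].
have [y] := @exists_large_fiber _ _ predT f l l_nil (fun _ _ => isT).
rewrite card_ffun !card_ord -size_filter; set s := filter _ _ => le_s.
have Us : uniq s by rewrite filter_uniq.
exists [seq P - head 0 s | P <- s]; rewrite size_map; split=> //.
  by rewrite map_inj_uniq //; apply: addIr.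
move=> _ /mapP[P sP ->]; set P0 := head 0 s.
have sP0 : P0 \in s by rewrite /P0; case: s sP {P0 Us le_s} => // *; apply: mem_head.
move: sP sP0; rewrite !mem_filter => /andP[/eqP fP lP1] /andP[/eqP fP0 lP2].
have [sP hP eP] := lP _ lP1; have [sP0 hP0 eP0] := lP _ lP2.
have cP i := leq_trans (leq_coef_hgt P i) hP.
have cP0 i := leq_trans (leq_coef_hgt P0 i) hP0.
split.
- apply/leq_sizeP=> j lt_j; rewrite coefB.
  have [le_j|gt_j] := leqP j n; last first.
    by rewrite !nth_default ?subrr // ?(leq_trans sP) ?(leq_trans sP0).
  have lt_e : (j - r.+1 < n - r)%N by move: lt_j le_j; clear; lia.
  have : f P (Ordinal lt_e) = f P0 (Ordinal lt_e) :> nat by rewrite fP fP0.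
  rewrite !ffunE /= subnKC // !inordK; last first.
  + by move: (_`_ _) (cP j); clear; lia.
  + by move: (_`_ _) (cP0 j); clear; lia.
  by move: (P`_ _) (P0`_ _) (cP j) (cP0 j); clear; lia.
- apply: hgt_leq => i; rewrite coefB.
  by move: (P`_ _) (P0`_ _) (cP i) (cP0 i); clear; lia.
rewrite evB mulr_natl mulr2n; apply: le_trans (ler_normB _ _) _.
exact: lerD.
Qed.

(** Here [9 ^ n] combines a [3 ^ n] from [2 * q + 1 <= 3 * q] in the pigeonhole with a [3 ^ n] from
    the cells of [size_leq_max_det]. The factorial of [n] and the power of [gelfond n] bound
    determinants of quotients, and the factorial of [2 * n] serves the resultant. *)
Definition count_const n := (9 ^ n * n`! * (2 * gelfond n) ^ n * (2 * n)`!)%N.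

Lemma exists_slow_step (D : nat -> nat) m n : (m <= n)%N -> (D n < D m + 2 * (n - m))%N ->
  exists r, [/\ (m <= r)%N, (r < n)%N & (D r.+1 <= (D r).+1)%N].
Proof.
elim: n => [|n IHn]; first by rewrite leqn0 => /eqP->; lia.
rewrite leq_eqVlt => /orP[/eqP->|]; first by lia.
rewrite ltnS => le_mn ltD.
have [slow|fast] := leqP (D n.+1) (D n).+1; first by exists n.
have [|r [mr rn Dr]] := IHn le_mn; first by lia.
by exists r; split=> //; apply: leqW.
Qed.

Lemma degrees_mono n (W W' : {poly int} -> Prop) :
  (forall w, W w -> W' w) -> (#|degrees n W| <= #|degrees n W'|)%N.
Proof.
move=> sub; apply/subset_leq_card/subsetP=> e /degreesP[w Ww sw].
by apply/degreesP; exists w => //; apply: sub.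
Qed.

Lemma gelfond_gt0 n : (0 < gelfond n)%N.
Proof. by rewrite !muln_gt0 !expn_gt0 !addnS. Qed.

(* Here [T] consists of the quotients by [G] of small polynomials. *)
Lemma size_quotients_leq (R : realFieldType) (x X : R) n d (q : nat)
    (G : {poly int}) (T : {poly int} -> Prop) (s : seq {poly int}) :
    (0 < d)%N -> G != 0 -> (size G + d <= n.+2)%N ->
    (forall j, (j < d)%N -> exists2 w : {poly int}, zspan T w & size w = j.+1) ->
    (forall S, T S -> [/\ (size S <= d)%N, (hgt (G * S) <= 2 * q)%N & `|ev x (G * S)| <= 2 * X]) ->
    uniq s -> (forall S, S \in s -> T S) -> 0 <= X ->
  let C : R := (3 ^ d * d`! * (2 * gelfond n) ^ d)%:R in
  (size s)%:R * (hgt G)%:R ^+ d <= C * q%:R ^+ d /\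
  (size s)%:R * (hgt G)%:R ^+ d.-1 * `|ev x G| <= C * q%:R ^+ d.-1 * X.
Proof.
move=> d_gt0 nzG sGd Tj Tb Us sT X_ge0.
have G_gt0 : (0 < hgt G)%N by rewrite hgt_gt0.
set K := gelfond n; have K_gt0 : (0 < K)%N := gelfond_gt0 n.
have hgtT S : T S -> (hgt G * hgt S <= 2 * K * q)%N.
  move=> TS; have [sS hS _] := Tb S TS.
  apply: (@leq_trans (K * hgt (G * S))%N).
    by apply: hgt_mul_leq; rewrite (leq_trans _ sGd) // leq_add2l.
  by rewrite [(2 * K)%N]mulnC -mulnA leq_mul2l hS orbT.
have [V [TV nzV le_s]] : exists V : 'M[int]_d, [/\ forall i, exists2 p, T p & row i V = poly_rV p,
    \det V != 0 & (size s <= 3 ^ d * absz (\det V))%N].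
  apply: (@size_leq_exists_det d (2 * K * q)) => // S TS; have [sS _ _] := Tb S TS.
  split=> //; apply: leq_trans (hgtT S TS).
  by rewrite leq_pmull.
pose A : 'M[R]_d := map_mx intr V.
have detA : (absz (\det V))%:R = `|\det A|.
  by rewrite det_map_mx -intr_norm -abszE.
pose h : R := (hgt G)%:R; have h_gt0 : 0 < h by rewrite ltr0n.
(* By [hgtT], dividing by [G] lowers the height bound by the factor [h], up to a constant; [Z] below
   does the same for values at [x]. *)
pose Y : R := (2 * K * q)%:R / h.
have Y_ge0 : 0 <= Y by rewrite divr_ge0 ?ler0n.
have AY i j : `|A i j| <= Y.
  have [S TS /rowP/(_ j)] := TV i; rewrite !mxE => ->.
  rewrite -intr_norm -abszE -[_%:~R]/(_%:R) ler_pdivlMr // -natrM ler_nat.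
  apply: leq_trans (hgtT S TS); rewrite mulnC leq_mul2l.
  by rewrite leq_coef_hgt orbT.
have le_sR : (size s)%:R <= (3 ^ d)%:R * `|\det A| by rewrite -detA -natrM ler_nat.
have Yh : Y * h = (2 * K * q)%:R by rewrite divfK // gt_eqF.
split.
  have detY : `|\det A| <= d`!%:R * Y ^+ d.
    by apply: (det_norm_leq (B := fun _ _ => Y)) => // s'; rewrite prodr_const card_ord.
  apply: (@le_trans _ _ ((3 ^ d)%:R * (d`!%:R * Y ^+ d) * h ^+ d)).
    rewrite ler_wpM2r ?exprn_ge0 ?(ltW h_gt0) //.
    by apply: le_trans le_sR _; rewrite ler_wpM2l ?ler0n.
  rewrite -!mulrA -exprMn Yh -!natrX -!natrM ler_nat.
  by rewrite expnMn !mulnA.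
have [->|nz_e] := eqVneq (ev x G) 0.
  by rewrite normr0 mulr0 !mulr_ge0 ?exprn_ge0 ?ler0n.
have e_gt0 : 0 < `|ev x G| by rewrite normr_gt0.
pose Z := 2 * X / `|ev x G|.
have Z_ge0 : 0 <= Z by rewrite divr_ge0 ?mulr_ge0.
have detY : `|\det A| <= d`!%:R * (Z * Y ^+ d.-1).
  apply: (det_horner_leq (x := x) (y := fun _ => Y) (z := fun _ => Z)) => // i.
    have [S TS defS] := TV i; have [sS _ eS] := Tb S TS.
    rewrite (_ : \sum_j _ = ev x S).
      by rewrite ler_pdivlMr // mulrC -normrM -evM.
    rewrite (ev_coef_wide _ sS); apply: eq_bigr => j _.
    by move/rowP/(_ j): defS; rewrite !mxE => ->.
  by rewrite prodr_const cardC1 card_ord.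
apply: (@le_trans _ _ ((3 ^ d)%:R * (d`!%:R * (Z * Y ^+ d.-1)) * h ^+ d.-1 * `|ev x G|)).
  rewrite ler_wpM2r // ler_wpM2r ?exprn_ge0 ?(ltW h_gt0) //.
  by apply: le_trans le_sR _; rewrite ler_wpM2l ?ler0n.
have -> : (3 ^ d)%:R * (d`!%:R * (Z * Y ^+ d.-1)) * h ^+ d.-1 * `|ev x G| =
    (3 ^ d)%:R * d`!%:R * (Y * h) ^+ d.-1 * 2 * X.
  rewrite [(Y * h) ^+ _]exprMn /Z; move: (Y ^+ _) (h ^+ _) => a b.
  by field; rewrite gt_eqF.
rewrite Yh ler_wpM2r // -!natrX -!natrM ler_nat expnMn.
have -> : ((2 * K) ^ d = (2 * K) ^ d.-1 * (2 * K))%N by rewrite -expnSr prednK.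
move: (3 ^ _)%N ((2 * K) ^ _)%N (q ^ _)%N => a b c.
have -> : (a * d`! * (b * (2 * K)) * c = a * d`! * (b * c) * 2 * K)%N by ring.
by rewrite leq_pmulr.
Qed.

Lemma ev1 (R : realFieldType) (x : R) : ev x 1 = 1.
Proof. by rewrite /ev rmorph1 hornerC. Qed.

(** The factors 2 arise because these polynomials are obtained as differences of two polynomials
    with bounds [q] and [X]. *)
Definition small (R : realFieldType) (x X : R) (q r : nat) (p : {poly int}) :=
  [/\ (size p <= r.+1)%N, (hgt p <= 2 * q)%N & `|ev x p| <= 2 * X].

Lemma small_mulX (R : realFieldType) (x X : R) q r p : `|x| <= 1 ->
  small x X q r p -> small x X q r.+1 (p * 'X).
Proof.
move=> x1 [sp hp ep]; split.
- have [->|nzp] := eqVneq p 0; first by rewrite mul0r size_poly0.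
  by rewrite size_mulX.
- apply: hgt_leq => i; rewrite coefMX; case: eqP => // _.
  exact: leq_trans (leq_coef_hgt _ _) hp.
by rewrite evM evX normrM (le_trans _ ep) // ler_piMr.
Qed.

Lemma size_zspan_small (R : realFieldType) (x X : R) q r w :
  zspan (small x X q r) w -> (size w <= r.+1)%N.
Proof.
apply: (zspan_ind_closed (W := fun w => (size w <= r.+1)%N)); last by move=> p [].
split=> [|a p v sp sv]; first by rewrite size_poly0.
rewrite (leq_trans (size_polyD _ _)) // geq_max sv andbT.
by rewrite (leq_trans (size_scale_leq _ _)).
Qed.

Lemma zspan_divl (B : {poly int} -> Prop) (G S : {poly int}) : G != 0 ->
    (forall p, B p -> exists S', p = G * S') -> zspan B (G * S) ->
  zspan (fun S' => B (G * S')) S.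
Proof.
move=> nzG BG.
pose W w := exists2 S', zspan (fun S' => B (G * S')) S' & w = G * S'.
have cW : zclosed W.
  split=> [|a _ _ [S1 BS1 ->] [S2 BS2 ->]]; first by exists 0; [apply: zspan0 | rewrite mulr0].
  exists (a *: S1 + S2); last by rewrite mulrDr scalerAr.
  by case: (zclosed_zspan (fun S' => B (G * S'))) => _; apply.
have BW p : B p -> W p.
  by move=> Bp; have [S' defp] := BG p Bp; exists S' => //; apply: zspan_gen; rewrite -defp.
by move/(zspan_ind_closed cW BW) => [S' BS' /(mulfI nzG)->].
Qed.

(* [d] and [c] are the dimension and the codimension of the space spanned by the
   small polynomials of degree less than [c + d], [g] and [H] are the degree and
   the height of their greatest common divisor [G], and [Y] is [|G(x)|]. *)
Lemma many_small_polys (R : realFieldType) (x X : R) n k q (l : seq {poly int}) :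
    (0 < n)%N -> (2 * k <= n.+1)%N -> (k <= n)%N -> (0 < q)%N -> `|x| <= 1 -> uniq l ->
    (forall P, P \in l ->
       [/\ irreducibleZ P, size P = n.+1, (hgt P <= q)%N & `|ev x P| <= X]) ->
    ((5 * q) ^ (n.+1 - k) < size l)%N ->
  exists (c d g H : nat) (Y : R),
    [/\ [/\ (c + d <= n)%N, (n < c + d + k)%N, (0 < d)%N, (g <= c)%N & (0 < H)%N],
        0 <= Y /\ (g = 0%N -> H = 1%N /\ Y = 1),
        (size l)%:R * H%:R ^+ d <= (count_const n)%:R * q%:R ^+ (n.+1 - c) :> R,
        (size l)%:R * H%:R ^+ d.-1 * Y <= (count_const n)%:R * q%:R ^+ (n - c) * X &
        (0 < g)%N -> 1 <= (count_const n)%:R *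
          (X * q%:R ^+ g.-1 * H%:R ^+ n + Y * q%:R ^+ g * H%:R ^+ n.-1)].
Proof.
move=> n_gt0 k2n kn q_gt0 x1 Ul lP big_l.
have [P0 lP0] : exists P, P \in l.
  by case: (l) big_l => // P l' _; exists P; apply: mem_head.
have [irr0 s0 h0 e0] := lP _ lP0.
have X_ge0 : 0 <= X by apply: le_trans e0.
pose W r := zspan (small x X q r); pose D r := #|degrees n (W r)|.
have cW r : zclosed (W r) by apply: zclosed_zspan.
have sub r w : W r w -> W r.+1 w.
  apply: zspan_ind_closed => // p [sp hp ep]; apply: zspan_gen.
  by split=> //; apply: leqW.
have fib r : (r <= n)%N -> exists L : seq {poly int}, [/\ uniq L,
    forall p, p \in L -> small x X q r p & (size l <= (2 * q).+1 ^ (n - r) * size L)%N].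
  by move=> rn; apply: exists_common_top => // P /lP[_ ->].
have lexp a b e : (a <= b)%N -> (a ^ e <= b ^ e)%N by case: e => // e; rewrite leq_exp2r.
(* Each coefficient above degree [r] costs a factor [2 * q + 1], each degree of [W r] a factor
   [4 * q + 1]; as [q >= 1], both are at most [5 * q]. *)
have cnt r : (r <= n)%N -> (size l <= (5 * q) ^ (n - r + D r))%N.
  move=> rn; have [L [UL LB le_l]] := fib r rn.
  apply: leq_trans le_l _; rewrite expnD leq_mul //.
    by apply: lexp; lia.
  apply: leq_trans (size_leq_degrees (n := n) (h := 2 * q) (cW r) _ UL _) _.
  - by move=> w /size_zspan_small/leq_trans; apply.
  - by move=> p /LB Bp; split; [apply: zspan_gen | case: Bp].
  by apply: lexp; lia.
have Dnk : (n.+1 - k < k + D (n - k))%N.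
  have := leq_trans big_l (cnt (n - k)%N (leq_subr _ _)).
  by rewrite subKn // ltn_exp2l //; lia.
have Dn : (D n <= n.+1)%N by rewrite -[leqRHS]card_ord max_card.
(* Growth by two at every step from [n - k] to [n] would give [D n >= D (n - k) + 2 * k], which
   exceeds [n + 1] by [Dnk]. *)
have [|r [nkr rn Dr]] := @exists_slow_step D (n - k) n (leq_subr _ _); first by rewrite subKn //; lia.
have D_mono r' : (n - k <= r')%N -> (D (n - k) <= D r')%N.
  elim: r' => [|r' IH]; first by rewrite leqn0 => /eqP->.
  rewrite leq_eqVlt => /orP[/eqP->//|/IH le]; apply: leq_trans le _.
  exact: degrees_mono (sub r').
have Dr_gt0 : (0 < D r)%N by apply: leq_trans (D_mono r nkr); lia.
have mulX w : W r w -> W r.+1 (w * 'X).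
  apply: (zspan_ind_closed (W := fun w => W r.+1 (w * 'X))).
    case: (cW r.+1) => W0 WD; split=> [|a u v Wu Wv]; first by rewrite mul0r.
    by rewrite mulrDl -scalerAl; apply: WD.
  by move=> p Bp; apply: zspan_gen; apply: small_mulX.
have [|A [g [d [sA d_gt0 degW szW AW]]]] :=
    stable_degrees_dvdp (cW r) (cW r.+1) (sub r) mulX _ Dr_gt0 Dr.
  by move=> w /size_zspan_small/leq_trans; apply.
have nzA : A != 0 by rewrite -size_poly_gt0 sA.
(* By Gauss's lemma, quotients by the primitive part are again integer polynomials. *)
pose G := zprimitive A.
have nzG : G != 0 by rewrite zprimitive_eq0.
have sG : size G = g.+1 by rewrite size_zprimitive.
have gd : (g + d <= r.+1)%N.
  have [|w Ww sw] := degW d.-1; first by rewrite prednK.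
  by have := size_zspan_small Ww; rewrite sw -addnS prednK.
have GW w : W r w -> exists S, w = G * S.
  by move=> Ww; have [S defw] := dvdpP_int (AW w Ww); exists S.
have BG p : small x X q r p -> exists S, p = G * S.
  by move=> Bp; apply: GW; apply: zspan_gen.
pose T S := small x X q r (G * S).
have [L [UL LB le_l]] := fib r (ltnW rn).
have /choice[h hE] (p : {poly int}) : exists S, p \in L -> p = G * S.
  have [pL|_] := boolP (p \in L); last by exists 0.
  by have [S] := BG p (LB p pL); exists S.
have Uh : uniq (map h L).
  by rewrite map_inj_in_uniq // => p p' pL pL' eq_h; rewrite (hE p pL) (hE p' pL') eq_h.
have sizeS S : W r (G * S) -> (size S <= d)%N.
  move=> WS; have [->|nzS] := eqVneq S 0; first by rewrite size_poly0.
  by have := szW _ WS; rewrite size_mul // sG addSn /= leq_add2l.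
have [] := @size_quotients_leq R x X n d q G T (map h L) d_gt0 nzG.
- by rewrite sG addSn ltnS (leq_trans gd) // leqW.
- move=> j lt_j; have [w Ww sw] := degW j lt_j; have [S defw] := GW w Ww.
  exists S; first by apply: zspan_divl => //; rewrite -defw.
  have nzS : S != 0.
    by apply/eqP=> S0; move: sw; rewrite defw S0 mulr0 size_poly0.
  by move: sw; rewrite defw size_mul // sG addSn /= -addnS => /addnI.
- by move=> S TS; case: (TS) => _ hS eS; split=> //; apply: sizeS; apply: zspan_gen.
- by [].
- by move=> _ /mapP[p pL ->]; rewrite /T -hE //; apply: LB.
- by [].
rewrite size_map => cnt1 cnt2.
have le_lR : (size l)%:R <= ((2 * q).+1 ^ (n - r))%:R * (size L)%:R :> R.
  by rewrite -natrM ler_nat.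
have const : ((2 * q).+1 ^ (n - r) * (3 ^ d * d`! * (2 * gelfond n) ^ d) <=
    count_const n * q ^ (n - r))%N.
  apply: (@leq_trans ((3 * q) ^ (n - r) * (3 ^ d * d`! * (2 * gelfond n) ^ d))%N).
    by rewrite leq_mul2r lexp ?orbT //; move: q_gt0; clear; lia.
  rewrite expnMn mulnAC leq_mul2r; apply/orP; right.
  have dn : (d <= n)%N by move: gd rn; clear; lia.
  apply: (@leq_trans (3 ^ n * (3 ^ n * n`! * (2 * gelfond n) ^ n))%N).
    do !apply: leq_mul; rewrite ?leq_fact // leq_pexp2l ?leq_subr //.
    by rewrite muln_gt0 gelfond_gt0.
  have -> : (count_const n = 3 ^ n * (3 ^ n * n`! * (2 * gelfond n) ^ n) * (2 * n)`!)%N.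
    by rewrite /count_const (expnMn 3 3); move: (_ ^ _)%N (_ ^ _)%N (_ `!) (_ `!) => *; ring.
  by rewrite leq_pmulr ?fact_gt0.
pose c := (r.+1 - d)%N.
exists c, d, g, (hgt G), `|ev x G|; split.
- by split=> //; rewrite ?hgt_gt0 // /c; move: gd nkr rn kn d_gt0; clear; lia.
(* For [g = 0], [A] is a nonzero constant and its primitive part is [1]. *)
- split=> // g0; move: sG nzG; rewrite g0 => /eqP; rewrite /G size_zprimitive => /size_poly1P[a nza ->].
  rewrite -[a%:P]mulr1 mul_polyC zprimitiveZ // zprimitive_monic ?monic1 // => _.
  by rewrite /hgt size_poly1 big_ord1 coef1 eqxx ev1 normr1.
- have -> : (n.+1 - c = n - r + d)%N by rewrite /c; move: gd rn d_gt0; clear; lia.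
  apply: le_trans (ler_wpM2r _ le_lR) _; first by rewrite exprn_ge0 ?ler0n.
  rewrite -mulrA; apply: le_trans (ler_wpM2l _ cnt1) _; first by rewrite ler0n.
  by rewrite -!natrX -!natrM ler_nat expnD mulnA [leqRHS]mulnA leq_mul2r const orbT.
- have -> : (n - c = n - r + d.-1)%N by rewrite /c; move: gd rn d_gt0; clear; lia.
  rewrite -[leLHS]mulrA; apply: le_trans (ler_wpM2r _ le_lR) _.
    by rewrite mulr_ge0 ?exprn_ge0 ?ler0n.
  rewrite -mulrA in cnt2; rewrite -[leLHS]mulrA.
  apply: le_trans (ler_wpM2l _ cnt2) _; first by rewrite ler0n.
  rewrite mulrA ler_wpM2r // -!natrX -!natrM ler_nat expnD mulnA [leqRHS]mulnA.
  by rewrite leq_mul2r const orbT.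
(* A single member of [l] suffices here: [G] has degree below [n], so it is coprime to the
   irreducible [P0]. *)
move=> g_gt0; have nzRes : resultant P0 G != 0.
  by apply: irreducible_resultant_neq0; rewrite // s0 sG ltnS; move: gd rn d_gt0; clear; lia.
apply: le_trans (resultant_geq1 n_gt0 g_gt0 x1 s0 sG nzRes h0 (leqnn _) e0 (lexx _)) _.
apply: ler_wpM2r; first by rewrite addr_ge0 ?mulr_ge0 ?exprn_ge0 ?ler0n.
rewrite ler_nat; apply: (@leq_trans (2 * n)`!); first by apply: leq_fact; move: gd rn d_gt0; clear; lia.
by rewrite leq_pmull // !muln_gt0 !expn_gt0 fact_gt0 muln_gt0 gelfond_gt0.
Qed.

(** * Counting *)

Lemma int_to_RE (z : int) : int_to_R z = z%:~R :> R.
Proof.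
case: z => k; rewrite /int_to_R /int_to_Z ?NegzE.
  by rewrite -INR_IZR_INZ INRE.
by rewrite opp_IZR -INR_IZR_INZ INRE mulrNz.
Qed.

Lemma evalRE (p : {poly int}) (x : R) : evalR p x = ev x p.
Proof.
rewrite (ev_coef_wide x (leqnn (size p))) /evalR.
elim: (polyseq p) => [|c s IHs] /=; first by rewrite big_ord0.
rewrite big_ord_recl /= expr0 mulr1 int_to_RE IHs RplusE RmultE; congr (_ + _).
rewrite big_distrr /=; apply: eq_bigr => j _.
by rewrite exprS mulrCA.
Qed.

(** The remainder for [j + 1] is [x] times the remainder for [j], plus
    [j * a ^ (j - 1) * (x - a) ^ 2]. So the constant grows by at most [j], and [j ^ 2] has room for
    this. *)
Lemma taylor_monomial (F : realFieldType) (x a : F) j : `|x| <= 1 -> `|a| <= 1 ->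
  `|x ^+ j - a ^+ j - j%:R * a ^+ j.-1 * (x - a)| <= (j ^ 2)%:R * (x - a) ^+ 2.
Proof.
move=> x1 a1; elim: j => [|j IHj].
  by rewrite !expr0 subrr !mul0r subrr normr0.
have ja : j%:R * a ^+ j.-1 * a = j%:R * a ^+ j :> F.
  by case: (j) => [|k]; rewrite ?mul0r // -mulrA -exprSr.
rewrite (_ : _ - _ - _ = x * (x ^+ j - a ^+ j - j%:R * a ^+ j.-1 * (x - a)) +
    j%:R * a ^+ j.-1 * (x - a) ^+ 2); last first.
  rewrite [x ^+ j.+1]exprS [a ^+ j.+1]exprS -natr1 /= expr2.
  have -> : j%:R * a ^+ j.-1 * ((x - a) * (x - a)) =
      x * (j%:R * a ^+ j.-1 * (x - a)) - j%:R * a ^+ j.-1 * a * (x - a) by ring.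
  by rewrite ja; ring.
apply: le_trans (ler_normD _ _) _.
rewrite (_ : (j.+1 ^ 2)%:R = (j ^ 2)%:R + (j.*2.+1)%:R); last first.
  by rewrite -natrD; congr (_%:R); rewrite -mul2n; ring.
rewrite mulrDl lerD //.
  by rewrite normrM (le_trans _ IHj) // ler_piMl.
rewrite normrM (ger0_norm (sqr_ge0 _)) ler_wpM2r ?sqr_ge0 //.
rewrite normrM normrX normr_nat (@le_trans _ _ j%:R) //.
  by rewrite ler_piMr ?ler0n // exprn_ile1.
by rewrite ler_nat; lia.
Qed.

Lemma ev_taylor (F : realFieldType) (x a : F) n q (p : {poly int}) :
    `|x| <= 1 -> `|a| <= 1 -> (size p <= n.+1)%N -> (hgt p <= q)%N ->
  `|ev x p - ev a p - ev a p^`() * (x - a)| <= (n.+1 ^ 3)%:R * q%:R * (x - a) ^+ 2.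
Proof.
move=> x1 a1 sp hp.
have dE : ev a p^`() = \sum_(j < n.+1) (p`_j)%:~R * (j%:R * a ^+ j.-1).
  rewrite (@ev_coef_wide _ _ n); last first.
    have [->|nzp] := eqVneq p 0; first by rewrite linear0 size_poly0.
    by rewrite -ltnS (leq_trans (lt_size_deriv nzp)).
  rewrite big_ord_recl /= mul0r mulr0 add0r; apply: eq_bigr => j _.
  by rewrite coef_deriv rmorphMn /= -[_ *+ _]mulr_natr -mulrA.
rewrite dE !(ev_coef_wide _ sp) mulr_suml -!sumrB.
apply: le_trans (ler_norm_sum _ _ _) _.
apply: (@le_trans _ _ (\sum_(j < n.+1) (n.+1 ^ 2)%:R * q%:R * (x - a) ^+ 2)).
  apply: ler_sum => j _.
  rewrite [X in `|X|](_ : _ = (p`_j)%:~R * (x ^+ j - a ^+ j - j%:R * a ^+ j.-1 * (x - a))).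
    rewrite normrM -[leRHS]mulrA [leRHS]mulrCA.
    apply: ler_pM => //.
      rewrite -intr_norm -abszE -[q%:R]/(q%:Z%:~R) ler_int lez_nat.
      exact: leq_trans (leq_coef_hgt _ _) hp.
    apply: le_trans (taylor_monomial _ x1 a1) _.
    by rewrite ler_wpM2r ?sqr_ge0 // ler_nat leq_exp2r // ltnW.
  by rewrite !mulrBr !mulrA.
by rewrite sumr_const card_ord [(n.+1 ^ 3)%N]expnS natrM -!mulrA [leRHS]mulr_natl.
Qed.

Lemma size_leq_sum_count (T : eqType) m (cls : 'I_m -> pred T) (l : seq T) :
    (forall P, P \in l -> exists i, cls i P) ->
  (size l <= \sum_i count (cls i) l)%N.
Proof.
move=> lcls; rewrite (eq_bigr (fun i => \sum_(P <- l) (cls i P : nat)))%N; last first.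
  by move=> i _; rewrite -sum1_count big_mkcond.
rewrite exchange_big -sum1_size big_seq [leqRHS]big_seq; apply: leq_sum => P lP.
by have [i clsi] := lcls P lP; rewrite (bigD1 i) //= clsi.
Qed.

Local Open Scope R_scope.

Lemma exists_natfloor (r : R) : 0 <= r -> exists m : nat, INR m <= r < INR m + 1.
Proof.
move=> /RleP r_ge0; exists (Num.truncn r); rewrite -S_INR !INRE.
by have /andP[/RleP lo /RltP hi] := truncn_itv r_ge0.
Qed.

(** A longer list would satisfy the hypotheses of [many_small_polys] with [q] the integer part of
    [Q] and [k] one more than that of [3 * s]; [exponents_contradiction] refutes the outcome. *)
Lemma local_count (n : nat) (C1 : R) : (3 <= n)%N -> 0 < C1 ->
  exists C2 Q0, [/\ 0 < C2, 1 <= Q0 &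
    forall (Q s x : R) (l : seq {poly int}), Q0 < Q -> / 5 <= s -> 16 * s <= INR n + 1 ->
      Rabs x <= 1 -> uniq l ->
      (forall P, P \in l -> [/\ irreducibleZ P, size P = n.+1, height_le P Q &
                              Rabs (ev x P) <= C1 * Rpower Q (1 - 4 * s)]) ->
      INR (size l) <= C2 * Rpower Q (INR n + 1 - 3 * s)].
Proof.
move=> n3 C1_gt0.
have n3R : 3 <= INR n by have /ssrnat.leP/le_INR /= := n3; rlra.
(* The second summand ensures that a too long list also exceeds [(5 * q) ^ (n.+1 - k)]. *)
pose C := INR (count_const n + 5 ^ n.+1).
have C_ge1 : 1 <= C.
  rewrite -[1]/(INR 1); apply/le_INR/ssrnat.leP.
  by rewrite addn_gt0 expn_gt0 orbT.
pose C2 := C * (1 + C1); have C2_gt0 : 0 < C2 by apply: Rmult_lt_0_compat; rlra.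
have C2_ge : C <= C2 by rewrite /C2; rnra.
(* The threshold is chosen so that [Q] to the power [3 / (25 * n)] exceeds [C2]. *)
exists C2, (Rmax 1 (Rpower C2 (25 * INR n / 3))); split=> //; first exact: Rmax_l.
move=> Q s x l ltQ s5 sn x1 Ul lP.
have Q1 : 1 < Q by apply: Rle_lt_trans ltQ; apply: Rmax_l.
have hQ : C2 < Rpower Q (3 / (25 * INR n)).
  rewrite -{1}[C2]Rpower_1 // (_ : 1 = 25 * INR n / 3 * (3 / (25 * INR n))); last by rfield; rlra.
  rewrite -Rpower_mult; apply: Rlt_Rpower_l; first by apply: Rdiv_lt_0_compat; rlra.
  split; first exact: exp_pos.
  by apply: Rle_lt_trans ltQ; apply: Rmax_r.
apply: Rnot_lt_le => bigN.
have [|q [qQ Qq]] := @exists_natfloor Q; first by rlra.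
have q_gt0 : (0 < q)%N.
  by rewrite lt0n; apply: contraTneq isT => q0; move: Qq; rewrite q0 /=; rlra.
have q_ge0 : 0 <= INR q by apply: pos_INR.
have [|k' [k1 k2]] := @exists_natfloor (3 * s); first by rlra.
pose k := k'.+1; have kE : INR k = INR k' + 1 by rewrite /k S_INR.
(* [2 * k <= 6 * s + 2 <= 16 * s <= n + 1], where the middle step is [s >= / 5], that is, the lower
   bound on v. *)
have k2n : (2 * k <= n.+1)%N.
  by apply/ssrnat.leP/INR_le; rewrite mul2n -addnn plus_INR kE (S_INR n); rlra.
have kn : (k <= n)%N by apply/ssrnat.leP/INR_le; rewrite kE; rlra.
have lP' P : P \in l ->
  [/\ irreducibleZ P, size P = n.+1, (hgt P <= q)%N & (`|ev x P| <= C1 * Rpower Q (1 - 4 * s))%R].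
  move=> /lP[irrP sP hP /RleP eP]; split=> //.
  apply: hgt_leq => i; have := hP i; rewrite int_to_RE RabsE -intr_norm => hi.
  rewrite -ltnS; apply/ssrnat.ltP/INR_lt; rewrite S_INR; apply: Rle_lt_trans Qq.
  by rewrite INRE.
have big_l : ((5 * q) ^ (n.+1 - k) < size l)%N.
  apply/ssrnat.ltP/INR_lt; apply: Rle_lt_trans bigN.
  have -> : INR ((5 * q) ^ (n.+1 - k))%N = INR (5 ^ (n.+1 - k))%N * INR q ^ (n.+1 - k).
    by rewrite RpowE RmultE !INRE -natrX -natrM expnMn.
  have le5 : INR (5 ^ (n.+1 - k))%N <= C2.
    apply: Rle_trans C2_ge; apply/le_INR/ssrnat.leP.
    by rewrite (leq_trans _ (leq_addl _ _)) // leq_pexp2l ?leq_subr.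
  apply: Rmult_le_compat => //; [exact: pos_INR | exact: pow_le |].
  apply: (@Rle_trans _ (Q ^ (n.+1 - k))); first by apply: pow_incr.
  rewrite -Rpower_pow; last by rlra.
  by apply: Rle_Rpower; [rlra | rewrite INR_subn ?(leqW kn) // kE S_INR; rlra].
have := @many_small_polys _ x _ n k q l (ltnW (ltnW n3)) k2n kn q_gt0 _ Ul lP' big_l.
case; first exact/RleP.
move=> c [d [g [H [Y [[cdn ncdk d_gt0 gc H_gt0] [Y0 g0] a b r]]]]].
have count_constC : INR (count_const n) <= C by apply/le_INR/ssrnat.leP/leq_addr.
have powq m : 0 <= INR q ^ m <= Q ^ m.
  by split; [apply: pow_le | apply: pow_incr].
have Cpow m : INR (count_const n) * INR q ^ m <= C * Q ^ m.
  apply: Rmult_le_compat => //; [exact: pos_INR | by case: (powq m) | by case: (powq m)].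
have X_ge0 : 0 <= C1 * Rpower Q (1 - 4 * s).
  by apply: Rmult_le_pos; [rlra | left; apply: exp_pos].
apply: (@exponents_contradiction n c d g k Q s (INR (size l)) (INR H) Y C C1) => //.
- by rlra.
- by rewrite -[1]/(INR 1); apply/le_INR/ssrnat.leP.
- by apply/RleP.
- by move=> /g0[-> ->].
- apply: Rle_trans (Cpow _); rewrite !RpowE !INRE; exact/RleP.
- apply: (@Rle_trans _ (INR (count_const n) * INR q ^ (n - c) * (C1 * Rpower Q (1 - 4 * s)))).
    by rewrite !RpowE !INRE; apply/RleP.
  exact: Rmult_le_compat_r.
move=> /r /RleP; rewrite -!INRE -!RpowE => r'; apply: Rle_trans r' _.
have H_ge0 m : 0 <= INR H ^ m by apply: pow_le; apply: pos_INR.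
have {}Y0 : 0 <= Y by apply/RleP.
have [qg0 qg] := powq g; have [qg1 qg1'] := powq g.-1.
apply: Rmult_le_compat => //; first exact: pos_INR.
  by apply: Rplus_le_le_0_compat; do 2 ?[apply: Rmult_le_pos => //].
by apply: Rplus_le_compat; apply: Rmult_le_compat_r => //; apply: Rmult_le_compat_l.
Qed.

(** Taylor expansion at the root [a]: the linear term is at most [Q] to the power [1 - v - 2 * s],
    and [2 * s <= v]; the quadratic one is at most a constant times [Q] to the power [1 - 4 * s]. *)
Lemma small_near_root (n : nat) (Q s v a x : R) (P : {poly int}) :
    1 < Q -> 0 <= s -> 2 * s <= v -> size P = n.+1 -> height_le P Q ->
    Rabs a <= 1 -> Rabs x <= 1 -> Rabs (x - a) <= Rpower Q (- (2 * s)) ->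
    evalR P a = 0 -> Rabs (evalR P^`() a) < Rpower Q (1 - v) ->
  Rabs (ev x P) <= (INR (n.+1 ^ 3) + 1) * Rpower Q (1 - 4 * s).
Proof.
move=> Q1 s0 sv sP hP a1 x1 xa Pa P'a.
have [|q [qQ Qq]] := @exists_natfloor Q; first by rlra.
have Pq : (hgt P <= q)%N.
  apply: hgt_leq => i; have := hP i; rewrite int_to_RE RabsE -intr_norm => hi.
  rewrite -ltnS; apply/ssrnat.ltP/INR_lt; rewrite S_INR; apply: Rle_lt_trans Qq.
  by rewrite INRE.
have /RleP : (`|ev x P - ev a P - ev a P^`() * (x - a)| <=
    (n.+1 ^ 3)%:R * q%:R * (x - a) ^+ 2)%R.
  by apply: ev_taylor; rewrite ?sP //; apply/RleP.
rewrite -!evalRE Pa -RabsE -!INRE -RpowE -!RmultE -!RminusE.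
set T := INR (n.+1 ^ 3); have T_ge0 : 0 <= T by apply: pos_INR.
set e := evalR P x; set e' := evalR P^`() a; set h := Rabs (x - a) in xa *.
rewrite (_ : forall y : R, y ^ 2 = Rabs y ^ 2) -/h; last by move=> y; rewrite pow2_abs.
move=> rem; rewrite -/e in rem *.
have h_ge0 : 0 <= h by apply: Rabs_pos.
have e'h : Rabs (e' * (x - a)) <= Rpower Q (1 - 4 * s).
  rewrite Rabs_mult; apply: (@Rle_trans _ (Rpower Q (1 - v) * Rpower Q (- (2 * s)))).
    by apply: Rmult_le_compat => //; [apply: Rabs_pos | apply: Rlt_le].
  by rewrite -Rpower_plus; apply: Rle_Rpower; rlra.
have h2 : T * INR q * h ^ 2 <= T * Rpower Q (1 - 4 * s).
  rewrite Rmult_assoc; apply: Rmult_le_compat_l => //.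
  rewrite (_ : 1 - 4 * s = 1 + (- (2 * s) + - (2 * s))); last by rring.
  rewrite !Rpower_plus Rpower_1; last by rlra.
  apply: Rmult_le_compat => //; [exact: pos_INR | by apply: pow_le |].
  by rewrite /= Rmult_1_r; apply: Rmult_le_compat.
have -> : e = (e - 0 - e' * (x - a)) + e' * (x - a) by rring.
apply: Rle_trans (Rabs_triang _ _) _.
rewrite Rmult_plus_distr_r Rmult_1_l; apply: Rplus_le_compat => //.
exact: Rle_trans rem h2.
Qed.

(* "#P_n(Q,v,I_0) <= B" is stated as: every duplicate-free list of elements
   of P_n(Q,v,I_0) has length <= B. *)
Theorem theorem3 (n : nat) (hn : (3 <= n)%N) :
  exists c1 Q0 : R, 0 < c1 /\ 0 < Q0 /\
    forall Q v : R, Q0 < Q -> 14 / 10 <= v <= 7 / 16 * (INR n + 1) ->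
    forall l : seq {poly int}, uniq l ->
      (forall P, P \in l -> inPn n Q v I0 P) ->
      INR (size l) <= c1 * Rpower Q (INR n + 1 - v / 7).
Proof.
pose C1 := INR (n.+1 ^ 3) + 1.
have C1_gt0 : 0 < C1 by have := pos_INR (n.+1 ^ 3); rewrite /C1; rlra.
have [C2 [Q0 [C2_gt0 Q0_ge1 cnt]]] := local_count hn C1_gt0.
(* The factor 2 comes from the number of grid points, [m + 1 <= U + 1 <= 2 * U]. *)
exists (2 * C2), Q0; split; first by rlra.
split; first by rlra.
move=> Q v ltQ [v_lo v_hi] l Ul lP.
have Q1 : 1 < Q by rlra.
pose s := v / 7; have vE : v = 7 * s by rewrite /s; rfield.
have s5 : / 5 <= s by rlra.
pose U := Rpower Q (2 * s).
have U_ge1 : 1 <= U by rewrite -(Rpower_O Q); [apply: Rle_Rpower|]; rlra.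
have [|m [mU Um]] := @exists_natfloor U; first by rlra.
have mR : INR m.+1 = INR m + 1 := S_INR m.
have m_gt0 : 0 < INR m.+1 by have := pos_INR m; rlra.
have UV : / U = Rpower Q (- (2 * s)) by rewrite Rpower_Ropp.
pose x (i : 'I_m.+1) := - / 2 + INR i * / INR m.+1.
pose small_at (i : 'I_m.+1) (P : {poly int}) :=
  (Rabs (ev (x i) P) <= C1 * Rpower Q (1 - 4 * s))%R.
have x1 i : Rabs (x i) <= 1.
  have i_ge0 := pos_INR i; have im : INR i <= INR m.+1 by apply/le_INR/ssrnat.leP/ltnW.
  have mV : 0 < / INR m.+1 by apply: Rinv_0_lt_compat.
  have : 0 <= INR i * / INR m.+1 by apply: Rmult_le_pos; rlra.
  have : INR i * / INR m.+1 <= INR m.+1 * / INR m.+1 by apply: Rmult_le_compat_r; rlra.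
  rewrite Rinv_r; last by rlra.
  by move=> *; apply: Rabs_le; rewrite /x; rlra.
have cover P : P \in l -> exists i, small_at i P.
  move=> /lP[_ [_ [sP [hP [_ [a [[a_lo a_hi] [Pa P'a]]]]]]]].
  have ma_ge0 : 0 <= (a + / 2) * INR m.+1 by apply: Rmult_le_pos; rlra.
  (* The grid point just to the left of [a], or equal to it; its distance to [a] is at most the step
     [1 / (m + 1)], which is below [1 / U]. *)
  have [i [ia ai]] := exists_natfloor ma_ge0.
  have lt_i : (i < m.+1)%N.
    apply/ssrnat.ltP/INR_lt; apply: Rle_lt_trans ia _.
    by rewrite -[X in _ < X]Rmult_1_l; apply: Rmult_lt_compat_r; rlra.
  exists (Ordinal lt_i); apply/RleP.
  apply: (@small_near_root n Q s v a) => //; try by rlra.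
    by apply: Rabs_le; rlra.
  rewrite -UV; apply: (@Rle_trans _ (/ INR m.+1)); last by apply: Rinv_le_contravar; rlra.
  have -> : x (Ordinal lt_i) - a = (INR i - (a + / 2) * INR m.+1) * / INR m.+1.
    by rewrite /x -[nat_of_ord _]/i; rfield; rlra.
  rewrite Rabs_mult (Rabs_pos_eq (/ _)); last by left; apply: Rinv_0_lt_compat.
  rewrite -[X in _ <= X]Rmult_1_l; apply: Rmult_le_compat_r; first by left; apply: Rinv_0_lt_compat.
  by apply: Rabs_le; rlra.
pose B := C2 * Rpower Q (INR n + 1 - 3 * s).
have cntB i : INR (count (small_at i) l) <= B.
  rewrite -size_filter; apply: (cnt Q s (x i)) => //.
  - by rlra.
  - exact: filter_uniq.
  - move=> P; rewrite mem_filter => /andP[/RleP Pi lPP].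
    by have [_ [irrP [sP [hP _]]]] := lP P lPP.
apply: (@Rle_trans _ (INR m.+1 * B)).
  apply: (@Rle_trans _ (INR (\sum_i count (small_at i) l))).
    exact/le_INR/ssrnat.leP/size_leq_sum_count.
  rewrite !INRE natr_sum RmultE mulr_natl -[X in (_ *+ X)%R](card_ord m.+1) -sumr_const.
  apply/RleP/ler_sum => i _; rewrite -INRE; exact/RleP.
apply: (@Rle_trans _ (2 * U * B)).
  apply: Rmult_le_compat_r; last by rlra.
  by apply: Rmult_le_pos; [rlra | left; apply: exp_pos].
(* The grid costs [2 * s] of the [3 * s] saved at each point, so [s = v / 7] remains. *)
right; rewrite /B /U -/s (_ : INR n + 1 - s = 2 * s + (INR n + 1 - 3 * s)); last by rring.
by rewrite [in RHS]Rpower_plus; rring.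
Qed.
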